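(* Let $V$ be an indecomposable object of ${}^{\mathcal K}_{\mathcal K}\mathcal{YD}$ such that the Nichols algebra $\mathfrak B(V)$ is finite-dimensional. Then $V$ is simple and isomorphic either to $\Bbbk_{\chi}$, $\Bbbk_{\chi^{3}}$, $V_{2,1}$, $V_{2,3}$, $V_{3,1}$ or $V_{3,3}$.
   Context: $\Bbbk$ is an algebraically closed field of characteristic zero and $\xi\in\Bbbk$ is a fixed primitive $4$-th root of unity. The Hopf algebra $\mathcal K$: $\mathcal K$ is the $8$-dimensional Hopf algebra generated as an algebra by $a,b,c,d$ with relations $ab=\xi ba$, $ac=\xi ca$, $cb=bc=0$, $cd=\xi dc$, $bd=\xi db$, $ad=da$, $ad=1$, $b^2=c^2=0$, $a^2c=b$, $a^4=1$; a linear basis is $\{1,a,b,c,d,a^2,ab,ac\}$. Its coalgebra structure and antipode are $\Delta(a)=a\otimes a+b\otimes c$, $\Delta(b)=a\otimes b+b\otimes d$, $\Delta(c)=c\otimes a+d\otimes c$, $\Delta(d)=c\otimes b+d\otimes d$, $\varepsilon(a)=\varepsilon(d)=1$, $\varepsilon(b)=\varepsilon(c)=0$, $\mathcal S(a)=d$, $\mathcal S(b)=\xi b$, $\mathcal S(c)=-\xi c$, $\mathcal S(d)=a$. ${}^{\mathcal K}_{\mathcal K}\mathcal{YD}$ is the category of finite-dimensional left Yetter-Drinfeld modules over $\mathcal K$: left modules and left comodules $M$ (coaction $\delta(m)=m_{(-1)}\otimes m_{(0)}$) with $\delta(h\cdot m)=h_{(1)}m_{(-1)}\mathcal S(h_{(3)})\otimes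 h_{(2)}\cdot m_{(0)}$. It is braided monoidal with braiding $c_{M,N}(m\otimes n)=m_{(-1)}\cdot n\otimes m_{(0)}$. Nichols algebra: $\mathfrak B(V)$ is the (unique up to isomorphism) $\mathbb N$-graded braided Hopf algebra $R=\bigoplus_{n\ge0}R(n)$ in ${}^{\mathcal K}_{\mathcal K}\mathcal{YD}$ (possibly infinite-dimensional) with $R(0)\simeq\Bbbk$, $R(1)\simeq V$, $R(1)$ equal to the space of primitive elements of $R$, and $R$ generated as an algebra by $R(1)$. One-dimensional objects: for $0\le j\le3$, $\Bbbk_{\chi^j}=\Bbbk v$ with $a\cdot v=\xi^jv$, $b\cdot v=c\cdot v=0$, $d\cdot v=\xi^{-j}v$, $\delta(v)=a^{2j}\otimes v$. Two-dimensional objects: for $i\in\mathbb Z_4$ and $j\in\{1,3\}$, put $\lambda=\xi^i$; $V_{i,j}$ has basis $e_1,e_2$, action $a\cdot e_1=\lambda e_1$, $b\cdot e_1=c\cdot e_1=0$, $d\cdot e_1=\lambda^{-1}e_1$, $a\cdot e_2=-\xi\lambda e_2$, $b\cdot e_2=\lambda^2e_1$, $c\cdot e_2=e_1$, $d\cdot e_2=\xi\lambda^{-1}e_2$, and coaction: for $j=1$, $\delta(e_1)=d\otimes e_1+(\lambda^3-\xi\lambda)c\otimes e_2$, $\delta(e_2)=a\otimes e_2+\frac12(\lambda+\xi\lambda^3)b\otimes e_1$; for $j=3$, $\delta(e_1)=a\otimes e_1+(\lambda^3+\xi\lambda)b\otimes e_2$, $\delta(e_2)=d\otimes e_2+\frac12(\lambda-\xi\lambda^3)c\otimes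 e_1$. *)

(* Defs.v *)
From HB Require Import structures.
From mathcomp Require Import all_boot all_order all_algebra all_field.
From mathcomp Require Import boolp.
Set Implicit Arguments.
Unset Strict Implicit.
Unset Printing Implicit Defensive.
Import GRing.Theory.
Local Open Scope ring_scope.
Local Open Scope quotient_scope.

(* The tensor product of two (possibly infinite-dimensional) vector spaces:
   finite formal sums of pairs, two sums being identified when every bilinear
   map takes the same value on both. *)
Section TensorProduct.
Variables (k : fieldType) (U V : lmodType k).
Implicit Types (s t : seq (U * V)).

Definition bilin_eval (W : lmodType k) (f : U -> V -> W) s : W :=
  \sum_(p <- s) f p.1 p.2.

Definition tens_eqv s t : bool :=
  `[< forall (W : lmodType k) (f : {bilinear U -> V -> W}),
        bilin_eval f s = bilin_eval f t >].

Lemma tens_eqv_refl : reflexive tens_eqv.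
Proof. by move=> s; apply/asboolP. Qed.

Lemma tens_eqv_sym : symmetric tens_eqv.
Proof. by move=> s t; apply/asboolP/asboolP => e W f; rewrite e. Qed.

Lemma tens_eqv_trans : transitive tens_eqv.
Proof.
by move=> t s r /asboolP e /asboolP e'; apply/asboolP => W f; rewrite e e'.
Qed.

Canonical tens_equiv_rel :=
  EquivRel tens_eqv tens_eqv_refl tens_eqv_sym tens_eqv_trans.

Definition tensor := {eq_quot tens_eqv}.

HB.instance Definition _ := Choice.on tensor.
HB.instance Definition _ := EqQuotient.on tensor.

Definition pure (u : U) (v : V) : tensor := \pi_tensor [:: (u, v)].

(* The linear map on the tensor product induced by f; only meaningful when f is
   bilinear, see tliftE and tlift_linear. *)
Definition tlift (W : lmodType k) (f : U -> V -> W) (x : tensor) : W :=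
  bilin_eval f (repr x).

Lemma tlift_pi (W : lmodType k) (f : {bilinear U -> V -> W}) s :
  tlift f (\pi_tensor s) = bilin_eval f s.
Proof.
rewrite /tlift.
have /eqmodP/asboolP : repr (\pi_tensor s) = s %[mod tensor] by rewrite reprK.
exact.
Qed.

Lemma tensor_eqP (x y : tensor) :
  (forall (W : lmodType k) (f : {bilinear U -> V -> W}), tlift f x = tlift f y)
  <-> x = y.
Proof.
split=> [e|-> //]; rewrite -[x]reprK -[y]reprK; apply/eqmodP/asboolP => W f.
exact: e.
Qed.

Definition tens_zero : tensor := \pi_tensor [::].
Definition tens_opp (x : tensor) : tensor :=
  \pi_tensor [seq (- p.1, p.2) | p <- repr x].
Definition tens_add (x y : tensor) : tensor := \pi_tensor (repr x ++ repr y).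
Definition tens_scale (a : k) (x : tensor) : tensor :=
  \pi_tensor [seq (a *: p.1, p.2) | p <- repr x].

Section Lift.
Variables (W : lmodType k) (f : {bilinear U -> V -> W}).

Lemma tlift0 : tlift f tens_zero = 0.
Proof. by rewrite tlift_pi /bilin_eval big_nil. Qed.

Lemma tliftD x y : tlift f (tens_add x y) = tlift f x + tlift f y.
Proof. by rewrite tlift_pi /bilin_eval big_cat. Qed.

Lemma tliftN x : tlift f (tens_opp x) = - tlift f x.
Proof.
rewrite tlift_pi /bilin_eval big_map -sumrN.
by apply: eq_bigr => p _; rewrite linearNl.
Qed.

Lemma tliftZ a x : tlift f (tens_scale a x) = a *: tlift f x.
Proof.
rewrite tlift_pi /bilin_eval big_map scaler_sumr.
by apply: eq_bigr => p _; rewrite linearZl_LR.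
Qed.

End Lift.

Let liftE := (tlift0, tliftD, tliftN, tliftZ).

Fact tens_addA : associative tens_add.
Proof. by move=> x y z; apply/tensor_eqP => W f; rewrite !liftE addrA. Qed.
Fact tens_addC : commutative tens_add.
Proof. by move=> x y; apply/tensor_eqP => W f; rewrite !liftE addrC. Qed.
Fact tens_add0 : left_id tens_zero tens_add.
Proof. by move=> x; apply/tensor_eqP => W f; rewrite !liftE add0r. Qed.
Fact tens_addN : left_inverse tens_zero tens_opp tens_add.
Proof. by move=> x; apply/tensor_eqP => W f; rewrite !liftE addNr. Qed.

HB.instance Definition _ :=
  GRing.isZmodule.Build tensor tens_addA tens_addC tens_add0 tens_addN.

Fact tens_scaleA a b x : tens_scale a (tens_scale b x) = tens_scale (a * b) x.
Proof. by apply/tensor_eqP => W f; rewrite !liftE scalerA. Qed.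
Fact tens_scale1 : left_id 1 tens_scale.
Proof. by move=> x; apply/tensor_eqP => W f; rewrite !liftE scale1r. Qed.
Fact tens_scaleDr : right_distributive tens_scale +%R.
Proof. by move=> a x y; apply/tensor_eqP => W f; rewrite !liftE scalerDr. Qed.
Fact tens_scaleDl x : {morph tens_scale^~ x : a b / a + b}.
Proof. by move=> a b; apply/tensor_eqP => W f; rewrite !liftE scalerDl. Qed.

HB.instance Definition _ := GRing.Zmodule_isLmodule.Build k tensor
  tens_scaleA tens_scale1 tens_scaleDr tens_scaleDl.

Lemma tlift_linear (W : lmodType k) (f : {bilinear U -> V -> W}) :
  linear (tlift f : tensor -> W).
Proof. by move=> a x y; rewrite [LHS]tliftD tliftZ. Qed.

Lemma tliftE (W : lmodType k) (f : {bilinear U -> V -> W}) u v :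
  tlift f (pure u v) = f u v.
Proof. by rewrite tlift_pi /bilin_eval big_seq1. Qed.

Lemma pure_bilinear :
  bilinear_for (GRing.Scale.Law.clone _ _ *:%R _)
    (GRing.Scale.Law.clone _ _ *:%R _) pure.
Proof.
by split=> [v|u] a x y; apply/tensor_eqP => W f;
   rewrite tlift_linear !tliftE ?linearPl ?linearPr.
Qed.

HB.instance Definition _ :=
  bilinear_isBilinear.Build k U V tensor _ _ pure pure_bilinear.

Lemma tensorE (x : tensor) : x = \sum_(p <- repr x) pure p.1 p.2.
Proof.
apply/tensor_eqP => W f; rewrite [LHS]/tlift /bilin_eval.
elim: (repr x) => [|p s IHs]; first by rewrite !big_nil [RHS]tlift0.
by rewrite !big_cons [RHS]tliftD tliftE IHs.
Qed.

End TensorProduct.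

Notation "U ⊗ V" := (tensor U V) (at level 40, left associativity) : type_scope.
Notation "u ⊠ v" := (pure u v) (at level 40, left associativity) : ring_scope.

Section TensorMaps.
Variable k : fieldType.
Implicit Types U V W : lmodType k.

Definition tmap U V U' V' (f : U -> U') (g : V -> V') : U ⊗ V -> U' ⊗ V' :=
  tlift (fun u v => f u ⊠ g v).

Definition tassoc U V W : (U ⊗ V) ⊗ W -> U ⊗ (V ⊗ W) :=
  tlift (fun x w => tlift (fun u v => u ⊠ (v ⊠ w)) x).

(* in_tensor S T t: t lies in the image of S ⊗ T in U ⊗ V *)
Definition in_tensor U V (S : {pred U}) (T : {pred V}) (t : U ⊗ V) : Prop :=
  exists2 s : seq (U * V), all (fun p => (p.1 \in S) && (p.2 \in T)) s &
    t = \sum_(p <- s) p.1 ⊠ p.2.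

Definition finite_dim U : Prop :=
  exists s : seq U, forall u, exists c : 'I_(size s) -> k,
    u = \sum_(i < size s) c i *: s`_i.

End TensorMaps.

Definition tensmul (k : fieldType) (A B : algType k) (s t : A ⊗ B) : A ⊗ B :=
  tlift (fun x y => tlift (fun z w => (x * z) ⊠ (y * w)) t) s.

Section Coalgebra.
Variables (k : fieldType) (C : lmodType k) (D : C -> C ⊗ C) (e : C -> k^o).

Record coalgebra_axioms : Prop := CoalgebraAxioms {
  coalg_comul_linear : linear D;
  coalg_counit_linear : linear e;
  coalg_coassoc : forall x, tassoc (tmap D id (D x)) = tmap id D (D x);
  coalg_counitl : forall x, tlift (fun y z => e y *: z) (D x) = x;
  coalg_counitr : forall x, tlift (fun y z => e z *: y) (D x) = x
}.

End Coalgebra.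

Section Hopf.
Variables (k : fieldType) (A : algType k).
Variables (D : A -> A ⊗ A) (e : A -> k^o) (S : A -> A).

Record antipode_axioms : Prop := AntipodeAxioms {
  antipode_linear : linear S;
  antipodel : forall x, tlift (fun y z => S y * z) (D x) = e x *: 1;
  antipoder : forall x, tlift (fun y z => y * S z) (D x) = e x *: 1
}.

Record hopf_axioms : Prop := HopfAxioms {
  hopf_coalgebra : coalgebra_axioms D e;
  hopf_comul1 : D 1 = 1 ⊠ 1;
  hopf_comulM : forall x y, D (x * y) = tensmul (D x) (D y);
  hopf_counit1 : e 1 = 1;
  hopf_counitM : forall x y, e (x * y) = e x * e y;
  hopf_antipode : antipode_axioms
}.

End Hopf.

Record hopfAlg (k : fieldType) := HopfAlg {
  hopf_alg :> falgType k;
  comul : hopf_alg -> hopf_alg ⊗ hopf_alg;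
  counit : hopf_alg -> k^o;
  antipode : hopf_alg -> hopf_alg;
  hopfP : hopf_axioms comul counit antipode
}.

Section YetterDrinfeld.
Variables (k : fieldType) (H : hopfAlg k).

Record ydData (M : lmodType k) := YDData {
  act : H -> M -> M;
  coact : M -> H ⊗ M
}.

Record yd_axioms (M : lmodType k) (y : ydData M) : Prop := YDAxioms {
  yd_act_linearl : forall m, linear ((act y)^~ m);
  yd_act_linearr : forall h, linear (act y h);
  yd_act1 : forall m, act y 1 m = m;
  yd_actM : forall g h m, act y (g * h) m = act y g (act y h m);
  yd_coact_linear : linear (coact y);
  yd_coassoc : forall m,
    tassoc (tmap (@comul k H) id (coact y m)) = tmap id (coact y) (coact y m);
  yd_counit : forall m, tlift (fun (h : H) n => counit h *: n) (coact y m) = m;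
  (* coact (h . m) = h_(1) m_(-1) S(h_(3)) (x) h_(2) . m_(0) *)
  yd_compat : forall h m,
    coact y (act y h m) =
    tlift (fun h12 h3 =>
      tlift (fun h1 h2 =>
        tlift (fun n m0 => (h1 * n * antipode h3) ⊠ act y h2 m0) (coact y m))
      h12) (tmap (@comul k H) id (comul h))
}.

Record ydMod := YDMod {
  yd_space :> lmodType k;
  yd_data :> ydData yd_space;
  ydP : yd_axioms yd_data
}.

Definition yd_unit : ydData k^o :=
  YDData (fun h x => counit h *: x) (fun x => 1 ⊠ x).

Definition yd_tensor (M N : lmodType k) (y : ydData M) (z : ydData N) :
    ydData (M ⊗ N) :=
  YDData
    (fun h t => tlift (fun h1 h2 => tmap (act y h1) (act z h2) t) (comul h))
    (tlift (fun m n =>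
      tlift (fun g m0 =>
        tlift (fun h n0 => (g * h) ⊠ (m0 ⊠ n0)) (coact z n)) (coact y m))).

Definition braiding (M N : lmodType k) (y : ydData M) (z : ydData N) :
    M ⊗ N -> N ⊗ M :=
  tlift (fun m n => tlift (fun h m0 => act z h n ⊠ m0) (coact y m)).

Record yd_morph (M N : lmodType k) (y : ydData M) (z : ydData N)
    (f : M -> N) : Prop := YDMorph {
  yd_morph_linear : linear f;
  yd_morph_act : forall h m, f (act y h m) = act z h (f m);
  yd_morph_coact : forall m, coact z (f m) = tmap id f (coact y m)
}.

Definition yd_iso (M N : lmodType k) (y : ydData M) (z : ydData N) : Prop :=
  exists f : M -> N, yd_morph y z f /\ bijective f.

Definition yd_sub (M : lmodType k) (y : ydData M) (S : {pred M}) : Prop :=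
  [/\ submod_closed S,
      forall h m, m \in S -> act y h m \in S &
      forall m, m \in S -> in_tensor predT S (coact y m)].

(* the subobject S of z is isomorphic to y *)
Definition yd_sub_iso (M N : lmodType k) (y : ydData M) (z : ydData N)
    (S : {pred N}) : Prop :=
  exists f : M -> N,
    [/\ yd_morph y z f, injective f &
        forall n, n \in S <-> exists m, n = f m].

Definition yd_simple (V : ydMod) : Prop :=
  (exists v : V, v != 0) /\
  forall S : {pred V}, yd_sub V S ->
    (forall v, v \in S -> v = 0) \/ (forall v, v \in S).

Definition yd_indecomposable (V : ydMod) : Prop :=
  (exists v : V, v != 0) /\
  forall S T : {pred V}, yd_sub V S -> yd_sub V T ->
    (forall v, exists s t, [/\ s \in S, t \in T & v = s + t]) ->
    (forall v, v \in S -> v \in T -> v = 0) ->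
    (forall v, v \in S -> v = 0) \/ (forall v, v \in T -> v = 0).

(* the product of the braided tensor square: (x(x)y)(z(x)w) = x c(y(x)z) w *)
Definition braided_tensmul (R : algType k) (y : ydData R) (s t : R ⊗ R) :
    R ⊗ R :=
  tlift (fun x x' =>
    tlift (fun z z' =>
      tlift (fun p q => (x * p) ⊠ (q * z')) (braiding y y (x' ⊠ z))) t) s.

Record braided_hopf_axioms (R : algType k) (y : ydData R)
    (D : R -> R ⊗ R) (e : R -> k^o) (S : R -> R) : Prop := BraidedHopfAxioms {
  bh_yd : yd_axioms y;
  bh_mul_morph : yd_morph (yd_tensor y y) y (tlift *%R);
  bh_one_morph : yd_morph yd_unit y (fun c => c *: 1);
  bh_comul_morph : yd_morph y (yd_tensor y y) D;
  bh_counit_morph : yd_morph y yd_unit e;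
  bh_antipode_morph : yd_morph y y S;
  bh_coalgebra : coalgebra_axioms D e;
  bh_comul1 : D 1 = 1 ⊠ 1;
  bh_comulM : forall x x', D (x * x') = braided_tensmul y (D x) (D x');
  bh_counit1 : e 1 = 1;
  bh_counitM : forall x x', e (x * x') = e x * e x';
  bh_antipode : antipode_axioms D e S
}.

Record grading_axioms (R : algType k) (y : ydData R)
    (D : R -> R ⊗ R) (e : R -> k^o) (S : R -> R) (G : nat -> {pred R}) :
    Prop := GradingAxioms {
  gr_sub : forall n, yd_sub y (G n);
  gr_span : forall x, exists n, exists2 z : nat -> R,
    (forall i, z i \in G i) & x = \sum_(i < n) z i;
  gr_direct : forall n (z : nat -> R), (forall i, z i \in G i) ->
    \sum_(i < n) z i = 0 -> forall i, (i < n)%N -> z i = 0;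
  gr_one : 1 \in G 0%N;
  gr_mul : forall m n x x', x \in G m -> x' \in G n -> x * x' \in G (m + n)%N;
  gr_comul : forall n x, x \in G n -> exists2 t : 'I_n.+1 -> R ⊗ R,
    (forall i : 'I_n.+1, in_tensor (G i) (G (n - i)%N) (t i)) &
    D x = \sum_(i < n.+1) t i;
  gr_counit : forall n x, (0 < n)%N -> x \in G n -> e x = 0;
  gr_antipode : forall n x, x \in G n -> S x \in G n
}.

Record gradedBraidedHopf := GradedBraidedHopf {
  gbh_alg :> algType k;
  gbh_yd : ydData gbh_alg;
  gbh_comul : gbh_alg -> gbh_alg ⊗ gbh_alg;
  gbh_counit : gbh_alg -> k^o;
  gbh_antipode : gbh_alg -> gbh_alg;
  gbh_deg : nat -> {pred gbh_alg};
  gbh_hopfP : braided_hopf_axioms gbh_yd gbh_comul gbh_counit gbh_antipode;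
  gbh_gradedP :
    grading_axioms gbh_yd gbh_comul gbh_counit gbh_antipode gbh_deg
}.

Arguments gbh_deg : clear implicits.

Record is_nichols (V : ydMod) (R : gradedBraidedHopf) : Prop := IsNichols {
  nichols_deg0 : yd_sub_iso yd_unit (gbh_yd R) (gbh_deg R 0);
  nichols_deg1 : yd_sub_iso V (gbh_yd R) (gbh_deg R 1);
  nichols_primitive : forall x : R,
    x \in gbh_deg R 1 <-> gbh_comul x = x ⊠ 1 + 1 ⊠ x;
  nichols_generated : forall S : {pred R}, subalg_closed S ->
    (forall x, x \in gbh_deg R 1 -> x \in S) -> forall x, x \in S
}.

End YetterDrinfeld.

Arguments YDData {k H M}.
Arguments gbh_deg {k H} g _ _.

(* The words 1, a, b, c, d, a^2, ab, ac; they are evaluated both in the Hopf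
   algebra, where they form the basis, and in matrix algebras, to define
   representations. *)
Definition Kwords (R : pzRingType) (a b c d : R) : 8.-tuple R :=
  [tuple 1; a; b; c; d; a ^+ 2; a * b; a * c].

(* The relations together with the basis determine the algebra; the values on
   a, b, c, d then determine the comultiplication, counit and antipode. *)
Record is_K (k : fieldType) (xi : k) (K : hopfAlg k) (a b c d : K) : Prop :=
  IsK {
  K_ab : a * b = xi *: (b * a);
  K_ac : a * c = xi *: (c * a);
  K_cb : c * b = 0;
  K_bc : b * c = 0;
  K_cd : c * d = xi *: (d * c);
  K_bd : b * d = xi *: (d * b);
  K_adC : a * d = d * a;
  K_ad : a * d = 1;
  K_b2 : b ^+ 2 = 0;
  K_c2 : c ^+ 2 = 0;
  K_a2c : a ^+ 2 * c = b;
  K_a4 : a ^+ 4 = 1;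
  K_basis : basis_of {:K}%VS (Kwords a b c d);
  K_comul_a : comul a = a ⊠ a + b ⊠ c;
  K_comul_b : comul b = a ⊠ b + b ⊠ d;
  K_comul_c : comul c = c ⊠ a + d ⊠ c;
  K_comul_d : comul d = c ⊠ b + d ⊠ d;
  K_counit_a : counit a = 1;
  K_counit_b : counit b = 0;
  K_counit_c : counit c = 0;
  K_counit_d : counit d = 1;
  K_antipode_a : antipode a = d;
  K_antipode_b : antipode b = xi *: b;
  K_antipode_c : antipode c = - xi *: c;
  K_antipode_d : antipode d = a
}.

(* The objects below are given by their action and coaction only; yd_iso V _
   compares these data, and an isomorphism transports yd_axioms from V. *)
Section Objects.
Variables (k : fieldType) (xi : k) (K : hopfAlg k) (a b c d : K).

(* a, b, c, d act on column vectors by A, B, C, D, and the other basis elements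
   a^2, ab, ac by the corresponding words *)
Definition Kact n (A B C D : 'M[k]_n.+1) (h : K) (v : 'cV[k]_n.+1) :
    'cV[k]_n.+1 :=
  (\sum_(i < 8) coord (Kwords a b c d) i h *: tnth (Kwords A B C D) i) *m v.

Definition onedim (j : nat) : ydData K 'cV[k]_1 :=
  YDData (Kact (xi ^+ j)%:M 0 0 (xi ^- j)%:M)
         (fun v => a ^+ (2 * j) ⊠ v).

Definition e1 : 'cV[k]_2 := delta_mx 0 0.
Definition e2 : 'cV[k]_2 := delta_mx 1 0.

(* Column n of an operator is the image of e_n. *)
Definition twodim_act (l : k) : K -> 'cV[k]_2 -> 'cV[k]_2 :=
  Kact (l *: delta_mx 0 0 + (- xi * l) *: delta_mx 1 1)
       (l ^+ 2 *: delta_mx 0 1)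
       (delta_mx 0 1)
       (l^-1 *: delta_mx 0 0 + (xi * l^-1) *: delta_mx 1 1).

Definition twodim_coact1 (l : k) (v : 'cV[k]_2) : K ⊗ 'cV[k]_2 :=
  v 0 0 *: (d ⊠ e1 + (l ^+ 3 - xi * l) *: c ⊠ e2) +
  v 1 0 *: (a ⊠ e2 + (2^-1 * (l + xi * l ^+ 3)) *: b ⊠ e1).

Definition twodim_coact3 (l : k) (v : 'cV[k]_2) : K ⊗ 'cV[k]_2 :=
  v 0 0 *: (a ⊠ e1 + (l ^+ 3 + xi * l) *: b ⊠ e2) +
  v 1 0 *: (d ⊠ e2 + (2^-1 * (l - xi * l ^+ 3)) *: c ⊠ e1).

Definition twodim1 (i : nat) : ydData K 'cV[k]_2 :=
  YDData (twodim_act (xi ^+ i)) (twodim_coact1 (xi ^+ i)).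
Definition twodim3 (i : nat) : ydData K 'cV[k]_2 :=
  YDData (twodim_act (xi ^+ i)) (twodim_coact3 (xi ^+ i)).

End Objects.

(* Main.v *)
From HB Require Import structures.
Require Import Defs.
From mathcomp Require Import all_boot all_order all_algebra all_field.
From mathcomp Require Import boolp ring.
Import GRing.Theory.
Local Open Scope ring_scope.

(** The coaction of V has eight coefficients in the basis 1, a, b, c, d, a^2,
    ab, ac of K, and each of them is an operator on V:

      delta(v) = 1 (x) P v + a (x) A v + b (x) B v + c (x) C v + d (x) D v
                 + a^2 (x) Q v + ab (x) Y v + ac (x) X v.

    Coassociativity computes all the products of two of these operators
    ([op_opE]): P, Q, A, D are complementary projections, X maps the image of P
    into that of Q and Y conversely, and B and C are inverse bijections between
    the images of A and D.  The Yetter-Drinfeld compatibility at h = a and h = c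
    says how the operators commute with the actions of a and c, which generate
    the algebra K.

    Finiteness of the Nichols algebra is used through two criteria, which both
    exhibit an x in V none of whose powers vanishes: [vector_criterion], for an
    x = v such that c(v (x) v) = v (x) v, and [functional_criterion], for a
    functional f on V such that (f (x) f) c = f (x) f.  For a functional psi
    concentrated in degree 1, the skew derivation y |-> psi(y_(1)) y_(2) obeys
    a Leibniz rule twisted by the braiding ([skew_der_primM]).  The hypothesis
    of either criterion turns it into the usual rule for the derivative of
    x^n, and the factors n that appear are invertible in characteristic zero.

    First, P = 0 ([op_P0]).  A nonzero u = P u with X u = 0 spans a trivial
    comodule, hence c(u (x) u) = u (x) u; if there is none, then Y = 0 and any
    functional that factors through P meets the second criterion.  It follows
    that X = Y = 0.

    Next, a^2 = -1 and b = c = 0 on the image of Q.  If Q is nonzero, an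
    eigenvector u of a in that image and a functional f that is an eigenvector
    of the transpose give an endomorphism v |-> f(v) u of V; it is idempotent,
    so V is spanned by u because V is indecomposable ([onedim_structure]).

    Otherwise V is the sum of U = A V and B U.  Write alpha for a and beta for
    C a B on U.  The compatibility gives beta^2 = - alpha^2 and
    alpha beta = beta alpha, and expresses the action of c as a polynomial in
    alpha and beta.  A joint eigenvector u, with eigenvalues mu and nu, and a
    dual eigenfunctional give again an idempotent endomorphism, now of rank 2,
    so V has basis u, B u ([twodim_structure]).  Since nu^2 = - mu^2, either
    nu = xi mu, and V is V_{i,1} with xi^i = nu, or nu = - xi mu, and V is
    V_{i,3} with xi^i = mu.  The two criteria exclude mu = 1 and nu = 1, which
    leaves i = 2 and i = 3. *)

Set Implicit Arguments.
Unset Strict Implicit.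
Unset Printing Implicit Defensive.

(** * Linear maps out of tensor products *)

(** Bilinearity is an unbundled hypothesis here because the maps lifted below are
    assembled from actions, coactions and coproducts whose linearity is only known
    through the axiom records. *)
Section Lifting.
Variables (k : fieldType) (U V W : lmodType k) (f : U -> V -> W).
Hypotheses (fl : forall v, linear (f^~ v)) (fr : forall u, linear (f u)).

Let F : {bilinear U -> V -> W} :=
  HB.pack f (bilinear_isBilinear.Build k U V W _ _ f
    ((fun v => fl v), (fun u => fr u))).

Lemma tlift_lin : linear (tlift f).
Proof. exact: (@tlift_linear _ _ _ _ F). Qed.

Lemma tlift_pure u v : tlift f (u ⊠ v) = f u v.
Proof. exact: (@tliftE _ _ _ _ F). Qed.

Lemma tlift_add x y : tlift f (x + y) = tlift f x + tlift f y.
Proof. by rewrite -[x]scale1r tlift_lin !scale1r. Qed.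

Lemma tlift_zero : tlift f 0 = 0.
Proof. by apply: (addIr (tlift f 0)); rewrite -tlift_add !add0r. Qed.

Lemma tlift_sum (I : Type) (r : seq I) (x : I -> U ⊗ V) :
  tlift f (\sum_(i <- r) x i) = \sum_(i <- r) tlift f (x i).
Proof.
by elim: r => [|i r IHr]; rewrite ?big_nil ?tlift_zero // !big_cons tlift_add IHr.
Qed.

Lemma tlift_sum_pure (I : Type) (r : seq I) (g : I -> U) (h : I -> V) :
  tlift f (\sum_(i <- r) g i ⊠ h i) = \sum_(i <- r) f (g i) (h i).
Proof. by rewrite tlift_sum; apply: eq_bigr => i _; apply: tlift_pure. Qed.

End Lifting.

Lemma linear_id (k : pzRingType) (U : lmodType k) : linear (@id U).
Proof. by []. Qed.

Section LinearFacts.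
Variables (k : fieldType) (U V : lmodType k) (f : U -> V).
Hypothesis fL : linear f.

Lemma lin_add x y : f (x + y) = f x + f y.
Proof. by rewrite -[x]scale1r fL !scale1r. Qed.
Lemma lin0 : f 0 = 0.
Proof. by apply: (addIr (f 0)); rewrite -lin_add !add0r. Qed.
Lemma lin_scale a x : f (a *: x) = a *: f x.
Proof. by rewrite -[a *: x]addr0 fL lin0 addr0. Qed.
Lemma lin_opp x : f (- x) = - f x.
Proof. by rewrite -scaleN1r lin_scale scaleN1r. Qed.
Lemma lin_sub x y : f (x - y) = f x - f y.
Proof. by rewrite lin_add lin_opp. Qed.
Lemma lin_sum (I : Type) (r : seq I) (x : I -> U) :
  f (\sum_(i <- r) x i) = \sum_(i <- r) f (x i).
Proof.
by elim: r => [|i r IHr]; rewrite ?big_nil ?lin0 // !big_cons lin_add IHr.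
Qed.
End LinearFacts.

(** A lift is a sum over a representative of the tensor, so its linearity in a
    parameter does not depend on bilinearity. *)
Lemma tlift_param (k : fieldType) (U V W X : lmodType k) (F : X -> U -> V -> W)
    (t : U ⊗ V) :
  (forall u v, linear (fun x => F x u v)) -> linear (fun x => tlift (F x) t).
Proof.
move=> FL r x x'; rewrite /tlift /bilin_eval scaler_sumr -big_split /=.
by apply: eq_bigr => p _; rewrite FL.
Qed.

Lemma eq_tlift (k : fieldType) (U V W : lmodType k) (f g : U -> V -> W) t :
  (forall u v, f u v = g u v) -> tlift f t = tlift g t.
Proof. by move=> efg; apply: eq_bigr => p _. Qed.

Lemma mull_lin (k : fieldType) (A : algType k) (x : A) : linear (fun z => x * z).
Proof. by move=> r z z'; rewrite mulrDr scalerAr. Qed.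
Lemma mulr_lin (k : fieldType) (A : algType k) (x : A) : linear (fun z => z * x).
Proof. by move=> r z z'; rewrite mulrDl scalerAl. Qed.

Section TensorMaps.
Variables (k : fieldType).
Implicit Types U V W : lmodType k.

Lemma pure_linl U V (v : V) : linear (fun u : U => u ⊠ v).
Proof. by move=> r x y; rewrite linearPl. Qed.
Lemma pure_linr U V (u : U) : linear (fun v : V => u ⊠ v).
Proof. by move=> r x y; rewrite linearPr. Qed.

Section Tmap.
Variables (U V U' V' : lmodType k) (f : U -> U') (g : V -> V').
Hypotheses (fL : linear f) (gL : linear g).
Let hl (v : V) : linear (fun u : U => f u ⊠ g v).
Proof. by move=> r x y; rewrite fL pure_linl. Qed.
Let hr (u : U) : linear (fun v : V => f u ⊠ g v).
Proof. by move=> r x y; rewrite gL pure_linr. Qed.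
Lemma tmap_lin : linear (tmap f g).
Proof. exact: tlift_lin hl hr. Qed.
Lemma tmap_pure u v : tmap f g (u ⊠ v) = f u ⊠ g v.
Proof. exact: (tlift_pure hl hr). Qed.
End Tmap.

Section Tassoc.
Variables (U V W : lmodType k).
Let il (w : W) (v : V) : linear (fun u : U => u ⊠ (v ⊠ w)).
Proof. exact: pure_linl. Qed.
Let ir (w : W) (u : U) : linear (fun v : V => u ⊠ (v ⊠ w)).
Proof. by move=> r x y; rewrite pure_linl pure_linr. Qed.
Let hl (w : W) : linear (fun x : U ⊗ V => tlift (fun u v => u ⊠ (v ⊠ w)) x).
Proof. exact: tlift_lin (il w) (ir w). Qed.
Let hr (x : U ⊗ V) : linear (fun w : W => tlift (fun u v => u ⊠ (v ⊠ w)) x).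
Proof.
move=> r w w'; rewrite /tlift /bilin_eval scaler_sumr -big_split /=.
by apply: eq_bigr => p _; rewrite !pure_linr.
Qed.
Lemma tassoc_lin : linear (@tassoc k U V W).
Proof. exact: tlift_lin hl hr. Qed.
Lemma tassoc_pure u v w :
  tassoc ((u ⊠ v : U ⊗ V) ⊠ w) = u ⊠ (v ⊠ w) :> U ⊗ (V ⊗ W).
Proof. by rewrite /tassoc (tlift_pure hl hr) (tlift_pure (il w) (ir w)). Qed.
End Tassoc.
End TensorMaps.

Section TensMul.
Variables (k : fieldType) (A B : algType k).
Let inner_z (x : A) (y : B) w : linear (fun z : A => (x * z) ⊠ (y * w)).
Proof. by move=> r z z'; rewrite mull_lin pure_linl. Qed.
Let inner_w (x : A) (y : B) z : linear (fun w : B => (x * z) ⊠ (y * w)).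
Proof. by move=> r w w'; rewrite mull_lin pure_linr. Qed.
Let outer_x t (y : B) : linear (fun x : A => tlift (fun z w => (x * z) ⊠ (y * w)) t).
Proof. by apply: tlift_param => z w r x x'; rewrite mulr_lin pure_linl. Qed.
Let outer_y t (x : A) : linear (fun y : B => tlift (fun z w => (x * z) ⊠ (y * w)) t).
Proof. by apply: tlift_param => z w r y y'; rewrite mulr_lin pure_linr. Qed.

Lemma tensmulDl (s s' t : A ⊗ B) : tensmul (s + s') t = tensmul s t + tensmul s' t.
Proof. by rewrite /tensmul (tlift_add (outer_x t) (outer_y t)). Qed.

Lemma tensmulDr x y (t t' : A ⊗ B) :
  tensmul (x ⊠ y) (t + t') = tensmul (x ⊠ y) t + tensmul (x ⊠ y) t'.
Proof.
rewrite /tensmul !(tlift_pure (outer_x _) (outer_y _)).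
by rewrite (tlift_add (inner_z x y) (inner_w x y)).
Qed.

Lemma tensmul_pure (x z : A) (y w : B) :
  tensmul (x ⊠ y) (z ⊠ w) = (x * z) ⊠ (y * w).
Proof.
by rewrite /tensmul (tlift_pure (outer_x _) (outer_y _))
  (tlift_pure (inner_z x y) (inner_w x y)).
Qed.
End TensMul.

(** * Functionals on finite-dimensional spaces *)

(** Grow the subspace T by absorbing the vectors of s one at a time, keeping u
    outside: a vector v that would bring u into T + kv already lies in T + ku.  In
    the end T is a hyperplane complementary to u, and f is the coordinate along u. *)
Lemma functional_of_cover (k : fieldType) (V : lmodType k) (u : V) (s : seq V)
    (T : V -> Prop) :
  T 0 -> (forall r x y, T x -> T y -> T (r *: x + y)) -> ~ T u ->
  (forall v, exists t r (c : nat -> k),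
     T t /\ v = t + r *: u + \sum_(i < size s) c i *: s`_i) ->
  exists2 f : V -> k^o, linear f & f u = 1.
Proof.
elim: s T => [|v s IHs] T T0 Tlin Tu cover.
  have TZ r x : T x -> T (r *: x) by move=> Tx; rewrite -[_ *: _]addr0; apply: Tlin.
  have {}cover w : exists r, T (w - r *: u).
    have [t [r [c [Tt ->]]]] := cover w; exists r.
    by rewrite big_ord0 addr0 addrK.
  have uniq_r w r r' : T (w - r *: u) -> T (w - r' *: u) -> r = r'.
    move=> Tr Tr'; apply/eqP; rewrite -subr_eq0; apply/negPn/negP => nz; apply: Tu.
    have := TZ (r - r')^-1 _ (Tlin (-1) _ _ Tr Tr').
    rewrite scaleN1r opprB addrA subrK -scalerBl scalerA mulVf ?scale1r //.
  have [f fP] := choice cover.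
  exists f => [r x y|].
    apply: (uniq_r (r *: x + y)) => //.
    have := Tlin r _ _ (fP x) (fP y).
    by rewrite scalerBr addrACA -opprD scalerA -scalerDl.
  by apply: (uniq_r u) => //; rewrite scale1r subrr.
have TZ r x : T x -> T (r *: x) by move=> Tx; rewrite -[_ *: _]addr0; apply: Tlin.
have TD x y : T x -> T y -> T (x + y) by move=> Tx Ty; rewrite -[x]scale1r; apply: Tlin.
have [[t [r [Tt def_u]]]|nTu] := pselect (exists t r, T t /\ u = t + r *: v).
  apply: (IHs T) => // w; have [t' [r' [c [Tt' ->]]]] := cover w.
  have nz_r : r != 0.
    by apply/eqP => r0; apply: Tu; rewrite def_u r0 scale0r addr0.
  have -> : v = r^-1 *: (u - t).
    by rewrite def_u addrC addKr scalerA mulVf ?scale1r.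
  exists (t' - (c 0%N * r^-1) *: t), (r' + c 0%N * r^-1), (fun i => c i.+1).
  split; first by rewrite -scaleNr; apply: TD => //; apply: TZ.
  rewrite /= big_ord_recl /= addrA; congr (_ + _).
  rewrite scalerA scalerBr scalerDl -!addrA; congr (_ + _).
  by rewrite [RHS]addrC addrA.
apply: (IHs (fun x => exists t r, T t /\ x = t + r *: v)).
- by exists 0, 0; rewrite scale0r addr0.
- move=> r _ _ [t [q [Tt ->]]] [t' [q' [Tt' ->]]].
  exists (r *: t + t'), (r * q + q'); split; first exact: Tlin.
  by rewrite scalerDr addrACA scalerA -scalerDl.
- exact: nTu.
move=> w; have [t [r [c [Tt ->]]]] := cover w.
exists (t + c 0%N *: v), r, (fun i => c i.+1); split; first by exists t, (c 0%N).
by rewrite /= big_ord_recl /= addrA; congr (_ + _); rewrite addrAC.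
Qed.

Lemma finite_dim_functional (k : fieldType) (V : lmodType k) (u : V) :
  finite_dim V -> u != 0 -> exists2 f : V -> k^o, linear f & f u = 1.
Proof.
move=> [s sP] nz_u; apply: (@functional_of_cover k V u s (fun x => x = 0)) => //.
- by move=> r x y -> ->; rewrite scaler0 addr0.
- exact/eqP.
move=> v; have [c ->] := sP v.
pose c' n := if insub n is Some j then c j else 0.
have E (i : 'I_(size s)) : c' i = c i.
  by rewrite /c' insubT // => lti; congr (c _); apply: val_inj.
exists 0, 0, c'; split=> //; rewrite scale0r !add0r.
by under eq_bigr do rewrite -E.
Qed.

(** Any matrix with more rows than columns has a nonzero left kernel. *)
Lemma finite_dim_dependent (k : fieldType) (V : lmodType k) (x : nat -> V) :
  finite_dim V -> exists n (r : nat -> k),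
    \sum_(i < n) r i *: x i = 0 /\ exists2 i, (i < n)%N & r i != 0.
Proof.
case=> s sP; have [c cP] := choice sP.
pose M := \matrix_(i < (size s).+1, j < size s) c (x i) j.
have : kermx M != 0.
  rewrite -mxrank_eq0 mxrank_ker subn_eq0 -ltnNge.
  exact: leq_ltn_trans (rank_leq_col M) _.
case/rowV0Pn => w /sub_kermxP wM nz_w.
exists (size s).+1, (fun i => w 0 (inord i)); split.
  under eq_bigr do rewrite inord_val [x _]cP scaler_sumr.
  rewrite exchange_big big1 //= => j _.
  under eq_bigr do rewrite scalerA.
  rewrite -scaler_suml.
  have -> : \sum_(i < (size s).+1) w 0 i * c (x i) j = (w *m M) 0 j.
    by rewrite mxE; apply: eq_bigr => i _; rewrite mxE.
  by rewrite wM mxE scale0r.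
by case/rV0Pn: nz_w => i nz_i; exists i; rewrite ?inord_val.
Qed.

Lemma functional_scale_lin (k : fieldType) (V : lmodType k) (f : V -> k^o) (u : V) :
  linear f -> linear (fun v => (f v : k) *: u).
Proof. by move=> fL r x y; rewrite fL scalerDl -scalerA. Qed.

Section Eigen.
Variables (k : fieldType) (V : lmodType k) (T : V -> V).
Hypotheses (two_neq0 : (2%:R : k) != 0) (TL : linear T).

(** T - s and T + s compose to zero on v, so one of them kills a nonzero vector.
    The last clause remembers where the eigenvector comes from, which transports
    to it any property of v that T preserves. *)
Lemma eigenvector_of_square (v : V) (s : k) : v != 0 -> T (T v) = s ^+ 2 *: v ->
  exists t u, [/\ t ^+ 2 = s ^+ 2, u != 0, T u = t *: u & u = v \/ u = T v + s *: v].
Proof.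
move=> nz_v TTv; have [Tv|nz_u] := eqVneq (T v + s *: v) 0.
  exists (- s), v; split=> //; [by rewrite sqrrN | | by left].
  by apply/eqP; rewrite scaleNr -subr_eq0 opprK Tv.
exists s, (T v + s *: v); split=> //; last by right.
by rewrite (lin_add TL) (lin_scale TL) TTv scalerDr scalerA expr2 addrC.
Qed.

(** The transpose of (T + s) / 2s, which projects onto the eigenspace of s along
    that of -s when T^2 = s^2. *)
Definition halve (f : V -> k^o) (s : k) (w : V) : k^o :=
  (2%:R * s)^-1 * (f (T w) + s * f w).

Variables (f : V -> k^o) (s : k).
Hypotheses (fL : linear f) (s_neq0 : s != 0).

Lemma halve_lin : linear (halve f s).
Proof.
move=> r x y; rewrite /halve TL !fL /GRing.scale /=; ring.
Qed.

Lemma halve_eigen w : f (T (T w)) = s ^+ 2 * f w -> halve f s (T w) = s * halve f s w.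
Proof. move=> fTT; rewrite /halve fTT; ring. Qed.

Lemma halve_id u : T u = s *: u -> halve f s u = f u.
Proof.
move=> Tu; rewrite /halve Tu (lin_scale fL) /GRing.scale /=.
by field; rewrite s_neq0.
Qed.
End Eigen.

(** * Skew derivations of a braided Hopf algebra *)

Section Braiding.
Variables (k : fieldType) (H : hopfAlg k) (M : lmodType k) (y : ydData H M).
Hypothesis hY : yd_axioms y.

Lemma braiding_lin : linear (braiding y y).
Proof.
apply: tlift_lin => [n r m m'|m].
  rewrite (yd_coact_linear hY) tlift_lin // => [u|h] r0 u1 u2.
    by rewrite (yd_act_linearl hY) pure_linl.
  by rewrite pure_linr.
apply: tlift_param => u v r x x'.
by rewrite (yd_act_linearr hY) pure_linl.
Qed.

Lemma braiding_pure m n : braiding y y (m ⊠ n) =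
  tlift (fun h m0 => act y h n ⊠ m0) (coact y m).
Proof.
rewrite /braiding tlift_pure // => [n' r x x'|m'].
  rewrite (yd_coact_linear hY) tlift_lin // => [u|h] r0 u1 u2.
    by rewrite (yd_act_linearl hY) pure_linl.
  by rewrite pure_linr.
apply: tlift_param => u v r x x'.
by rewrite (yd_act_linearr hY) pure_linl.
Qed.

Lemma braiding_sum (sx : seq (H * M)) m n :
  coact y m = \sum_(q <- sx) q.1 ⊠ q.2 ->
  braiding y y (m ⊠ n) = \sum_(q <- sx) act y q.1 n ⊠ q.2.
Proof.
move=> def_m; rewrite braiding_pure def_m tlift_sum_pure // => [v|h] r x x'.
  by rewrite (yd_act_linearl hY) pure_linl.
by rewrite pure_linr.
Qed.

End Braiding.

Section SkewDerivations.
Variables (k : fieldType) (H : hopfAlg k) (R : gradedBraidedHopf H).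
Notation yR := (gbh_yd R).
Notation D := (@gbh_comul k H R).
Notation e := (@gbh_counit k H R).
Let hR := gbh_hopfP R.
Let hY := bh_yd hR.
Let hC := bh_coalgebra hR.

Let tens3_linl (x z' q : R) : linear (fun p : R => (x * p) ⊠ (q * z')).
Proof. by move=> r p p'; rewrite mull_lin pure_linl. Qed.
Let tens3_linr (x z' p : R) : linear (fun q : R => (x * p) ⊠ (q * z')).
Proof. by move=> r q q'; rewrite mulr_lin pure_linr. Qed.

Let inner x x' (z z' : R) :=
  tlift (fun p q => (x * p) ⊠ (q * z')) (braiding yR yR (x' ⊠ z)).

Let inner_z x x' z' : linear (fun z => inner x x' z z').
Proof.
move=> r z z2; rewrite /inner pure_linr (braiding_lin hY) tlift_lin //.
Qed.
Let inner_z' x x' z : linear (fun z' => inner x x' z z').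
Proof.
apply: tlift_param => p q r z1 z2.
by rewrite mull_lin pure_linr.
Qed.
Let inner_x x' z z' : linear (fun x => inner x x' z z').
Proof.
apply: tlift_param => p q r z1 z2.
by rewrite mulr_lin pure_linl.
Qed.
Let inner_x' x z z' : linear (fun x' => inner x x' z z').
Proof.
move=> r z1 z2; rewrite /inner pure_linl (braiding_lin hY) tlift_lin //.
Qed.

Lemma braided_tensmul_linl t : linear (fun s => braided_tensmul yR s t).
Proof.
apply: tlift_lin => [x' r x1 x2|x r x1 x2].
  by apply: (@tlift_param _ _ _ _ _ (fun x => inner x x')) => u v; apply: inner_x.
by apply: (@tlift_param _ _ _ _ _ (fun x' => inner x x')) => u v; apply: inner_x'.
Qed.

Lemma braided_tensmul_pure x x' (sy : seq (R * R)) :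
  braided_tensmul yR (x ⊠ x') (\sum_(p <- sy) p.1 ⊠ p.2) =
  \sum_(p <- sy) inner x x' p.1 p.2.
Proof.
rewrite /braided_tensmul tlift_pure => [|v r x1 x2|u r x1 x2].
- rewrite tlift_sum_pure // => [z'|z]; [exact: inner_z|exact: inner_z'].
- by apply: (@tlift_param _ _ _ _ _ (fun x => inner x v)) => z z'; apply: inner_x.
by apply: (@tlift_param _ _ _ _ _ (fun x' => inner u x')) => z z'; apply: inner_x'.
Qed.

Lemma coact_one : coact yR 1 = 1 ⊠ 1.
Proof.
have := yd_morph_coact (bh_one_morph hR) 1; rewrite scale1r => ->.
rewrite tmap_pure ?scale1r // => r x x'.
by rewrite scalerDl scalerA.
Qed.

Lemma inner1l x (z z' : R) : inner x 1 z z' = (x * z) ⊠ z'.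
Proof.
rewrite /inner (@braiding_sum _ _ _ _ hY [:: (1, 1)]) ?big_seq1 ?coact_one //=.
by rewrite (yd_act1 hY) tlift_pure ?mul1r // => q; apply: tens3_linl.
Qed.

Lemma comul_primM (x y : R) (sx : seq (H * R)) (sy : seq (R * R)) :
  D x = x ⊠ 1 + 1 ⊠ x -> coact yR x = \sum_(q <- sx) q.1 ⊠ q.2 ->
  D y = \sum_(p <- sy) p.1 ⊠ p.2 ->
  D (x * y) = \sum_(p <- sy) (x * p.1) ⊠ p.2 +
    \sum_(p <- sy) \sum_(q <- sx) act yR q.1 p.1 ⊠ (q.2 * p.2).
Proof.
move=> Dx dx Dy; rewrite (bh_comulM hR) Dx Dy.
rewrite (lin_add (braided_tensmul_linl _)) !braided_tensmul_pure.
congr (_ + _); apply: eq_bigr => p _; first exact: inner1l.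
rewrite /inner (braiding_sum hY _ dx) tlift_sum_pure.
- by apply: eq_bigr => q _; rewrite mul1r.
- by move=> q; apply: tens3_linl.
by move=> q; apply: tens3_linr.
Qed.

Definition skew_der (psi : R -> k^o) (y : R) : R :=
  tlift (fun p q => psi p *: q) (D y).

Section SkewDer.
Variables (psi : R -> k^o).
Hypothesis psiL : linear psi.

Let hl (q : R) : linear (fun p => psi p *: q).
Proof. by move=> r p p'; rewrite psiL scalerDl scalerA. Qed.
Let hr (p : R) : linear (fun q : R => psi p *: q).
Proof. by move=> r q q'; rewrite scalerDr !scalerA mulrC. Qed.

Lemma skew_der_lin : linear (skew_der psi).
Proof. by move=> r y y'; rewrite /skew_der (coalg_comul_linear hC) tlift_lin. Qed.

Lemma skew_der_sum (sy : seq (R * R)) y :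
  D y = \sum_(p <- sy) p.1 ⊠ p.2 ->
  skew_der psi y = \sum_(p <- sy) psi p.1 *: p.2.
Proof. by move=> Dy; rewrite /skew_der Dy tlift_sum_pure. Qed.

Lemma skew_der_one : skew_der psi 1 = psi 1 *: 1.
Proof. by rewrite /skew_der (bh_comul1 hR) tlift_pure. Qed.

End SkewDer.

(** Leibniz rule.  For x primitive, Delta(x y) = x y_(1) (x) y_(2) +
    c(x (x) y_(1)) y_(2), and the condition on psi holds in a Nichols algebra
    when psi vanishes outside degree 1.  The braiding survives as a sum over the coaction of x in
    which psi is translated by x_(-1). *)
Lemma skew_der_primM (psi : R -> k^o) (x y : R) (sx : seq (H * R)) :
  linear psi -> D x = x ⊠ 1 + 1 ⊠ x ->
  coact yR x = \sum_(q <- sx) q.1 ⊠ q.2 ->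
  (forall z, psi (x * z) = psi x * e z) ->
  skew_der psi (x * y) = psi x *: y +
    \sum_(q <- sx) q.2 * skew_der (fun z => psi (act yR q.1 z)) y.
Proof.
move=> psiL Dx dx psix.
pose sy := repr (D y); have Dy : D y = \sum_(p <- sy) p.1 ⊠ p.2 := tensorE _.
have psihL h : linear (fun z => psi (act yR h z) : k^o).
  by move=> r z z'; rewrite (yd_act_linearr hY) psiL.
rewrite /skew_der (comul_primM Dx dx Dy).
have hl (q : R) : linear (fun p => psi p *: q).
  by move=> r p p'; rewrite psiL scalerDl scalerA.
have hr (p : R) : linear (fun q : R => psi p *: q).
  by move=> r q q'; rewrite scalerDr !scalerA mulrC.
rewrite (tlift_add hl hr) tlift_sum_pure // tlift_sum //; congr (_ + _).
  rewrite -[in RHS](coalg_counitl hC y) Dy tlift_sum_pure.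
  - by rewrite scaler_sumr; apply: eq_bigr => p _; rewrite psix scalerA.
  - by move=> q r p p'; rewrite (coalg_counit_linear hC) scalerDl scalerA.
  by move=> p r q q'; rewrite scalerDr !scalerA mulrC.
under eq_bigr do rewrite tlift_sum_pure //.
rewrite exchange_big; apply: eq_bigr => q _.
rewrite -/(skew_der _ y) (skew_der_sum (psihL _) Dy) mulr_sumr.
by apply: eq_bigr => p _; rewrite scalerAr.
Qed.

End SkewDerivations.

(** * Two criteria for a Nichols algebra to be infinite-dimensional *)

Section Nichols.
Variables (k : fieldType) (H : hopfAlg k) (V : ydMod H) (R : gradedBraidedHopf H).
Hypothesis nR : is_nichols V R.
Notation yR := (gbh_yd R).
Notation yV := (yd_data V).
Notation D := (@gbh_comul k H R).
Notation e := (@gbh_counit k H R).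
Notation G := (gbh_deg R).
Let hR := gbh_hopfP R.
Let gR := gbh_gradedP R.
Let hY := bh_yd hR.
Let hC := bh_coalgebra hR.

Lemma deg0 n : 0 \in G n.
Proof. by have [[]] := gr_sub gR n. Qed.
Lemma deg_lin n r x y : x \in G n -> y \in G n -> r *: x + y \in G n.
Proof. by move=> xG yG; have [[_ h] _ _] := gr_sub gR n; apply: h. Qed.
Lemma degZ n r x : x \in G n -> r *: x \in G n.
Proof. by move=> xG; rewrite -[_ *: _]addr0 deg_lin ?deg0. Qed.
Lemma deg_exp x n : x \in G 1 -> x ^+ n \in G n.
Proof.
move=> xG; elim: n => [|n IHn]; first exact: gr_one gR.
by rewrite exprS -add1n; apply: (gr_mul gR).
Qed.

(** The powers of x sit in distinct degrees, hence would be independent. *)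
Lemma nonnilpotent_infinite (x : R) :
  finite_dim R -> x \in G 1 -> (forall n, x ^+ n != 0) -> False.
Proof.
move=> finR xG nz_x.
have [n [r [rel [i lt_in nz_r]]]] := finite_dim_dependent (fun i => x ^+ i) finR.
have rG j : r j *: x ^+ j \in G j by apply/degZ/deg_exp.
have /eqP := gr_direct gR rG rel lt_in.
by rewrite scaler_eq0 (negbTE nz_r) (negbTE (nz_x i)).
Qed.

(** The homogeneous components of x, as a sequence that vanishes from n on so
    that decompositions of different lengths can be compared. *)
Definition components (x : R) (z : nat -> R) (n : nat) :=
  [/\ forall i, z i \in G i, x = \sum_(i < n) z i & forall i, (n <= i)%N -> z i = 0].

Lemma components_ex x : exists z n, components x z n.
Proof.
have [n [z zG ->]] := gr_span gR x.
exists (fun i => if (i < n)%N then z i else 0), n; split=> [i||i].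
- by case: ifP => // _; apply: deg0.
- by apply: eq_bigr => i _; rewrite ltn_ord.
by rewrite ltnNge => ->.
Qed.

Lemma components_widen x z n m : components x z n -> (n <= m)%N -> components x z m.
Proof.
case=> zG -> z0 le_nm; split=> // [|i le_mi]; last exact/z0/(leq_trans le_nm).
rewrite -(subnKC le_nm) big_split_ord /= [X in _ + X]big1 ?addr0 // => i _.
by rewrite z0 ?leq_addr.
Qed.

Lemma components_uniq x z n z' n' i :
  components x z n -> components x z' n' -> z i = z' i.
Proof.
move=> xz xz'; pose m := maxn i.+1 (maxn n n').
have [zG def_x _] :=
  components_widen xz (leq_trans (leq_maxl n n') (leq_maxr _ _) : (n <= m)%N).
have [zG' def_x' _] :=
  components_widen xz' (leq_trans (leq_maxr n n') (leq_maxr _ _) : (n' <= m)%N).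
apply/eqP; rewrite -subr_eq0; apply/eqP.
have dG j : z j - z' j \in G j by rewrite addrC -scaleN1r deg_lin.
apply: (gr_direct gR dG (n := m)); last exact: leq_maxl.
by rewrite sumrB -def_x -def_x' subrr.
Qed.

Lemma components_comb r x z n x' z' n' :
  components x z n -> components x' z' n' ->
  components (r *: x + x') (fun i => r *: z i + z' i) (maxn n n').
Proof.
move=> xz xz'.
have [zG -> z0] := components_widen xz (leq_maxl n n').
have [zG' -> z0'] := components_widen xz' (leq_maxr n n').
split=> [i||i le_i]; first exact: deg_lin.
- by rewrite scaler_sumr -big_split.
by rewrite z0 // z0' // scaler0 addr0.
Qed.

Lemma components_hom x n :
  x \in G n -> components x (fun i => if i == n then x else 0) n.+1.
Proof.
move=> xG; split=> [i||i]; first by case: eqP => [->|_] //; apply: deg0.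
  rewrite (bigD1 (Ordinal (ltnSn n))) //= eqxx big1 ?addr0 // => i.
  by rewrite -val_eqE /= => /negbTE->.
by case: eqP => // ->; rewrite ltnn.
Qed.

Lemma components_act h x z n :
  components x z n -> components (act yR h x) (fun i => act yR h (z i)) n.
Proof.
have aL := yd_act_linearr hY h.
case=> zG -> z0; split=> [i||i le_ni]; last by rewrite z0 // (lin0 aL).
  by have [_ h1 _] := gr_sub gR i; apply: h1.
exact: (lin_sum aL).
Qed.

Lemma components_mul1 x y z n : x \in G 1 -> components y z n ->
  components (x * y) (fun i => if i is j.+1 then x * z j else 0) n.+1.
Proof.
move=> xG [zG -> z0]; split=> [[|i]||[|i] le_i //]; first exact: deg0.
- by rewrite -add1n; apply: (gr_mul gR).
- by rewrite big_ord_recl add0r mulr_sumr.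
by rewrite z0 // mulr0.
Qed.

Lemma deg0_scalar x : x \in G 0 -> exists r, x = r *: 1.
Proof.
have [f [fm _ fP]] := nichols_deg0 nR.
have fE c : f c = c *: f 1.
  by rewrite -(lin_scale (yd_morph_linear fm)) /GRing.scale /= mulr1.
case/fP => c ->; have [c1 def_1] := (fP 1).1 (gr_one gR).
have nz_c1 : c1 != 0.
  by apply/eqP=> c10; have := oner_neq0 R; rewrite def_1 fE c10 scale0r eqxx.
by exists (c / c1); rewrite def_1 [in LHS]fE [in RHS]fE scalerA divfK.
Qed.

Lemma counit_components y z n : components y z n -> z 0%N = e y *: 1.
Proof.
move=> yz; have [zG def_y _] := components_widen yz (leqnSn n).
have eL := coalg_counit_linear hC.
have [r def_z0] := deg0_scalar (zG 0%N).
rewrite def_z0; congr (_ *: _); rewrite def_y (lin_sum eL) big_ord_recl.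
rewrite big1 => [|i _]; last by apply: (gr_counit gR (n := i.+1)).
by rewrite addr0 def_z0 (lin_scale eL) (bh_counit1 hR) /GRing.scale /= mulr1.
Qed.

(** The inclusion of V as R(1) and the projection of R onto it.  Multiplying by
    an element of R(1) raises degrees, so only the scalar component of y
    contributes to the degree 1 part of iota v * y. *)
Lemma degree1_projection : exists iota : V -> R, exists rho : R -> V,
  [/\ yd_morph yV yR iota, forall v, iota v \in G 1,
      forall v, rho (iota v) = v, rho 1 = 0 & linear rho] /\
  (forall h x, rho (act yR h x) = act yV h (rho x)) /\
  (forall v y, rho (iota v * y) = e y *: v).
Proof.
have [iota [im injI iP]] := nichols_deg1 nR.
have iG v : iota v \in G 1 by apply/iP; exists v.
have iL := yd_morph_linear im.
have rho_ex x : exists v, exists z n, components x z n /\ z 1%N = iota v.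
  have [z [n xz]] := components_ex x; have [zG _ _] := xz.
  by have [v def_z1] := (iP _).1 (zG 1%N); exists v, z, n.
have [rho rhoP] := choice rho_ex.
have rhoE x z n v : components x z n -> z 1%N = iota v -> rho x = v.
  have [z' [n' [xz' def_rho]]] := rhoP x => xz def_v.
  by apply: injI; rewrite -def_rho -def_v; apply: components_uniq xz' xz.
exists iota, rho; split; first split=> //.
- by move=> v; apply: rhoE (components_hom (iG v)) _.
- by apply: rhoE (components_hom (gr_one gR)) _; rewrite (lin0 iL).
- move=> r x x'; have [z [n [xz zx]]] := rhoP x; have [z' [n' [xz' zx']]] := rhoP x'.
  by apply: rhoE (components_comb r xz xz') _; rewrite zx zx' iL.
split=> [h x|v y].
  have [z [n [xz zx]]] := rhoP x.
  by apply: rhoE (components_act h xz) _; rewrite zx (yd_morph_act im).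
have [z [n yz]] := components_ex y.
apply: rhoE (components_mul1 (iG v) yz) _.
by rewrite (counit_components yz) -scalerAr mulr1 (lin_scale iL).
Qed.

Section Criteria.
Hypotheses (char0 : [pchar k] =i pred0) (finV : finite_dim V) (finR : finite_dim R).

Lemma natr_neq0 n : (n.+1%:R : k) != 0.
Proof. by move/pcharf0P: char0 => ->. Qed.

(** By induction, the skew derivation along f of x^n is n f(v) x^(n-1), for
    every f at once: the Leibniz rule asks for the translates of f by the coaction
    of v, and c(v (x) v) = v (x) v recombines their values.  So x^n = 0 would imply
    x^(n-1) = 0. *)
Lemma vector_criterion v :
  v != 0 -> braiding yV yV (v ⊠ v) = v ⊠ v -> False.
Proof.
move=> nz_v c_vv.
have [iota [rho [[im iG iK rho1 rhoL] [rho_act rhoM]]]] := degree1_projection.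
have iL := yd_morph_linear im.
set x := iota v.
have [sx dv] : exists sx : seq (H * V), coact yV v = \sum_(q <- sx) q.1 ⊠ q.2.
  by exists (repr (coact yV v)); apply: tensorE.
rewrite (braiding_sum (ydP V) _ dv) in c_vv.
have dx : coact yR x = \sum_(q <- [seq (q.1, iota q.2) | q <- sx]) q.1 ⊠ q.2.
  rewrite /x (yd_morph_coact im) dv big_map (lin_sum (tmap_lin _ iL)) //.
  by apply: eq_bigr => q _; rewrite tmap_pure.
have Dx : D x = x ⊠ 1 + 1 ⊠ x by apply/(nichols_primitive nR)/iG.
have der_exp n (f : V -> k^o) : linear f ->
    skew_der (fun z => f (rho z)) (x ^+ n) = (n%:R * f v) *: x ^+ n.-1.
  elim: n f => [|n IHn] f fL.
    rewrite expr0 skew_der_one => [|r z z']; last by rewrite rhoL fL.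
    by rewrite rho1 (lin0 fL) mul0r !scale0r.
  have frL : linear (fun z => f (rho z)) by move=> r z z'; rewrite rhoL fL.
  rewrite exprS (skew_der_primM (x ^+ n) frL Dx dx) => [|z]; last first.
    by rewrite rhoM iK (lin_scale fL) mulrC.
  rewrite iK big_map /=.
  under eq_bigr => q _.
    rewrite (_ : (fun z => f _) = (fun z => f (act yV q.1 (rho z)))); last first.
      by apply: funext => z; rewrite rho_act.
    rewrite (IHn (fun w => f (act yV q.1 w))); last first.
      by move=> r w w'; rewrite (yd_act_linearr (ydP V)) fL.
    over.
  have := congr1 (tlift (fun a b => f a *: (iota b * x ^+ n.-1))) c_vv.
  rewrite tlift_sum_pure ?tlift_pure; first last.
  - by move=> w r u u'; rewrite iL mulr_lin scalerDr !scalerA mulrC.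
  - by move=> w r u u'; rewrite fL scalerDl scalerA.
  - by move=> w r u u'; rewrite iL mulr_lin scalerDr !scalerA mulrC.
  - by move=> w r u u'; rewrite fL scalerDl scalerA.
  move=> def_sum.
  under eq_bigr do rewrite -scalerAr -scalerA.
  rewrite -scaler_sumr def_sum -/x.
  case: n {IHn def_sum} => [|n].
    by rewrite expr0 scale0r addr0 mul1r.
  by rewrite -exprS scalerA -scalerDl /= -[in RHS]natr1 mulrDl mul1r addrC.
have [f fL fv] := finite_dim_functional finV nz_v.
apply: (@nonnilpotent_infinite x) => //; first exact: iG.
elim=> [|n IHn]; first by rewrite expr0 oner_neq0.
apply: contraNneq IHn => xn0; have := der_exp n.+1 f fL.
rewrite xn0 (lin0 (skew_der_lin _)) => [|r z z']; last by rewrite rhoL fL.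
by move/esym/eqP; rewrite fv mulr1 scaler_eq0 (negbTE (natr_neq0 n)).
Qed.

(** The hypothesis says (f (x) f) c = f (x) f, that is, f identifies a braided
    quotient of V with a line with trivial braiding.  Iterating n times the skew
    derivation along f and applying the counit gives a functional F n with
    F n (x^n) = n! f(v)^n. *)
Lemma functional_criterion (f : V -> k^o) v :
  linear f -> f v != 0 ->
  (forall u w, tlift (fun h u0 => (f u0 * f (act yV h w) : k^o))
      (coact yV u) = f u * f w) ->
  False.
Proof.
move=> fL nz_fv f_mult.
have [iota [rho [[im iG iK rho1 rhoL] [rho_act rhoM]]]] := degree1_projection.
have iL := yd_morph_linear im.
have eL := coalg_counit_linear hC.
pose phi (z : R) : k^o := f (rho z).
have phiL : linear phi by move=> r z z'; rewrite /phi rhoL fL.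
pose F := fix F n : R -> k^o := if n is m.+1 then fun y => F m (skew_der phi y) else e.
have FL n : linear (F n).
  by elim: n => [|n IHn] //= r z z'; rewrite (skew_der_lin phiL) IHn.
have coactE u : coact yV u = \sum_(q <- repr (coact yV u)) q.1 ⊠ q.2 := tensorE _.
have step m u y : F m.+1 (iota u * y) = f u * F m y +
    \sum_(q <- repr (coact yV u))
      F m (iota q.2 * skew_der (fun z => f (act yV q.1 (rho z))) y).
  have Dx : D (iota u) = iota u ⊠ 1 + 1 ⊠ iota u by apply/(nichols_primitive nR)/iG.
  have dx : coact yR (iota u) =
      \sum_(q <- [seq (q.1, iota q.2) | q <- repr (coact yV u)]) q.1 ⊠ q.2.
    rewrite (yd_morph_coact im) [in LHS]coactE big_map (lin_sum (tmap_lin _ iL)) //.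
    by apply: eq_bigr => q _; rewrite tmap_pure.
  rewrite /= (skew_der_primM y phiL Dx dx) => [|z]; last first.
    by rewrite /phi rhoM iK (lin_scale fL) mulrC.
  rewrite (lin_add (FL m)) (lin_scale (FL m)) (lin_sum (FL m)) /phi iK big_map /=.
  congr (_ + _); apply: eq_bigr => q _; congr (F m (_ * _)); apply: eq_tlift => z z'.
  by rewrite rho_act.
have fq u w : \sum_(q <- repr (coact yV u)) f q.2 * f (act yV q.1 w) = f u * f w.
  rewrite -f_mult [in RHS]coactE tlift_sum_pure // => [m|h] r z z'.
    by rewrite (yd_act_linearl (ydP V)) fL mulrDr /GRing.scale /= mulrCA.
  by rewrite fL mulrDl /GRing.scale /= mulrA.
have F_prim n u y : F n.+1 (iota u * y) = n.+1%:R * (f u * F n y).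
  elim: n u y => [|n IHn] u y; rewrite step.
    rewrite big1 ?addr0 ?mul1r // => q _.
    by rewrite /= (bh_counitM hR) (gr_counit gR (n := 1)) ?mul0r.
  pose sy := repr (D y); have Dy : D y = \sum_(p <- sy) p.1 ⊠ p.2 := tensorE _.
  have fqL h : linear (fun z => f (act yV h (rho z)) : k^o).
    by move=> r z z'; rewrite rhoL (yd_act_linearr (ydP V)) fL.
  under eq_bigr do rewrite IHn (skew_der_sum (fqL _) Dy) (lin_sum (FL n)).
  rewrite -mulr_sumr.
  under eq_bigr do rewrite mulr_sumr.
  rewrite exchange_big /=.
  rewrite (_ : \sum_(p <- sy) _ = f u * F n.+1 y); last first.
    rewrite /= (skew_der_sum phiL Dy) (lin_sum (FL n)) mulr_sumr.
    apply: eq_bigr => p _.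
    under eq_bigr do rewrite (lin_scale (FL n)) /GRing.scale /= mulrA.
    by rewrite -mulr_suml fq (lin_scale (FL n)) /GRing.scale /= mulrA.
  by rewrite -[in RHS]natr1 mulrDl mul1r addrC.
set x := iota v.
apply: (@nonnilpotent_infinite x) => //; first exact: iG.
move=> n; apply: contra_neq (_ : F n (x ^+ n) != 0) => [->|]; first exact: lin0 (FL n).
elim: n => [|n IHn]; first by rewrite /= (bh_counit1 hR) oner_neq0.
by rewrite exprS F_prim !mulf_neq0 ?natr_neq0.
Qed.

End Criteria.
End Nichols.

(** * Consequences of the Yetter-Drinfeld compatibility *)

HB.instance Definition _ (k : fieldType) (H : hopfAlg k) (V : ydMod H) (h : H) :=
  GRing.isLinear.Build k V V *:%R (act (yd_data V) h) (yd_act_linearr (ydP V) h).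

Section YDCompat.
Variables (k : fieldType) (H : hopfAlg k) (V : ydMod H).
Notation yV := (yd_data V).

(** The summand h_1 v_(-1) S(h_3) (x) h_2 . v_(0) of the compatibility axiom. *)
Definition compat_term (v : V) (h1 h2 h3 : H) : H ⊗ V :=
  tlift (fun n m0 => (h1 * n * antipode h3) ⊠ act yV h2 m0) (coact yV v).

Let SL := antipode_linear (hopf_antipode (hopfP H)).
Let DL := coalg_comul_linear (hopf_coalgebra (hopfP H)).

Lemma compat_term_sum (I : Type) (r : seq I) (g : I -> H) (m : I -> V) v h1 h2 h3 :
  coact yV v = \sum_(i <- r) g i ⊠ m i ->
  compat_term v h1 h2 h3 = \sum_(i <- r) (h1 * g i * antipode h3) ⊠ act yV h2 (m i).
Proof.
move=> dv; rewrite /compat_term dv tlift_sum_pure // => [m0|n] q x x'.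
  by rewrite mull_lin mulr_lin pure_linl.
by rewrite linearP pure_linr.
Qed.

Let ct1 v h2 h3 : linear (fun h1 => compat_term v h1 h2 h3).
Proof.
apply: tlift_param => n m q x x'.
by rewrite (mulr_lin n) mulr_lin pure_linl.
Qed.
Let ct2 v h1 h3 : linear (fun h2 => compat_term v h1 h2 h3).
Proof.
apply: tlift_param => n m q x x'.
by rewrite (yd_act_linearl (ydP V)) pure_linr.
Qed.
Let ct3 v h1 h2 : linear (fun h3 => compat_term v h1 h2 h3).
Proof.
apply: tlift_param => n m q x x'.
by rewrite SL mull_lin pure_linl.
Qed.

(** The elements a and c to which this applies have two-term coproducts, and so
    do the left tensor factors of these. *)
Lemma coact_act h h1 h2 h3 h4 x1 x2 x3 x4 y1 y2 y3 y4 v :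
  comul h = h1 ⊠ h2 + h3 ⊠ h4 ->
  comul h1 = x1 ⊠ x2 + x3 ⊠ x4 -> comul h3 = y1 ⊠ y2 + y3 ⊠ y4 ->
  coact yV (act yV h v) =
    compat_term v x1 x2 h2 + compat_term v x3 x4 h2 +
    (compat_term v y1 y2 h4 + compat_term v y3 y4 h4).
Proof.
move=> dh dh1 dh3; rewrite (yd_compat (ydP V)) dh (lin_add (tmap_lin DL _)) //.
have oL h' : linear (fun h12 => tlift (fun p q => compat_term v p q h') h12).
  by apply: tlift_lin => [q|p]; [apply: ct1|apply: ct2].
have oR h12 : linear (fun h' => tlift (fun p q => compat_term v p q h') h12).
  by apply: tlift_param => p q; apply: ct3.
have iL h' q : linear (fun p => compat_term v p q h') by apply: ct1.
have iR h' p : linear (fun q => compat_term v p q h') by apply: ct2.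
rewrite !tmap_pure // (tlift_add oL oR) !(tlift_pure oL oR) dh1 dh3.
by rewrite !(tlift_add (iL _) (iR _)) !(tlift_pure (iL _) (iR _)).
Qed.

End YDCompat.

(** * The algebra and coalgebra of K in its basis *)

Lemma sqr_prim4 (k : fieldType) (xi : k) : 4.-primitive_root xi -> xi ^+ 2 = -1.
Proof.
move=> hxi.
have : (xi ^+ 2) ^+ 2 == 1 by rewrite -exprM (prim_expr_order hxi).
by rewrite sqrf_eq1 -(prim_order_dvd hxi) => /orP[|/eqP].
Qed.

Section YetterDrinfeldOverK.
Variables (k : fieldType) (xi : k) (hxi : 4.-primitive_root xi).
Variables (K : hopfAlg k) (a b c d : K) (hK : is_K xi a b c d).
Notation W := (Kwords a b c d).

(** The positions of 1, a, b, c, d, a^2, ab, ac among the words of the basis. *)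
Definition o0 : 'I_8 := @Ordinal 8 0 isT.
Definition o1 : 'I_8 := @Ordinal 8 1 isT.
Definition o2 : 'I_8 := @Ordinal 8 2 isT.
Definition o3 : 'I_8 := @Ordinal 8 3 isT.
Definition o4 : 'I_8 := @Ordinal 8 4 isT.
Definition o5 : 'I_8 := @Ordinal 8 5 isT.
Definition o6 : 'I_8 := @Ordinal 8 6 isT.
Definition o7 : 'I_8 := @Ordinal 8 7 isT.

Lemma sum8 (M : zmodType) (F : 'I_8 -> M) :
  \sum_(i < 8) F i =
  F o0 + F o1 + F o2 + F o3 + F o4 + F o5 + F o6 + F o7.
Proof.
rewrite !big_ord_recl big_ord0 addr0 !addrA.
by congr (F _ + F _ + F _ + F _ + F _ + F _ + F _ + F _); apply: val_inj.
Qed.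

Lemma ord8_ind (p : 'I_8 -> Prop) :
  p o0 -> p o1 -> p o2 -> p o3 -> p o4 -> p o5 -> p o6 -> p o7 -> forall i, p i.
Proof.
move=> p0 p1 p2 p3 p4 p5 p6 p7 i.
have: i \in [:: o0; o1; o2; o3; o4; o5; o6; o7].
  by case: i => [[|[|[|[|[|[|[|[|i]]]]]]]] lti].
by rewrite !inE => /orP[|/orP[|/orP[|/orP[|/orP[|/orP[|/orP[|]]]]]]] /eqP->.
Qed.

Lemma coordW i j : coord W i (tnth W j) = (i == j)%:R.
Proof.
by rewrite (tnth_nth 0) coord_free 1?eq_sym // (basis_free (K_basis hK)).
Qed.

Lemma expandW h : h = \sum_(i < 8) coord W i h *: tnth W i.
Proof.
rewrite [LHS](coord_basis (K_basis hK) (memvf h)).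
by apply: eq_bigr => i _; rewrite (tnth_nth 0).
Qed.

Lemma coord_1 i : coord W i 1 = (i == o0)%:R. Proof. exact: (coordW i o0). Qed.
Lemma coord_a i : coord W i a = (i == o1)%:R. Proof. exact: (coordW i o1). Qed.
Lemma coord_b i : coord W i b = (i == o2)%:R. Proof. exact: (coordW i o2). Qed.
Lemma coord_c i : coord W i c = (i == o3)%:R. Proof. exact: (coordW i o3). Qed.
Lemma coord_d i : coord W i d = (i == o4)%:R. Proof. exact: (coordW i o4). Qed.
Lemma coord_a2 i : coord W i (a ^+ 2) = (i == o5)%:R. Proof. exact: (coordW i o5). Qed.
Lemma coord_ab i : coord W i (a * b) = (i == o6)%:R. Proof. exact: (coordW i o6). Qed.
Lemma coord_ac i : coord W i (a * c) = (i == o7)%:R. Proof. exact: (coordW i o7). Qed.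
Definition coord_words :=
  (coord_1, coord_a, coord_b, coord_c,
   coord_d, coord_a2, coord_ab, coord_ac).

Section Coef.
Variable (M : lmodType k).
Definition wcoef (i : 'I_8) (t : K ⊗ M) : M := tlift (fun h m => coord W i h *: m) t.
Let hl i (m : M) : linear (fun h : K => coord W i h *: m).
Proof. by move=> r h h'; rewrite linearP scalerDl scalerA. Qed.
Let hr i (h : K) : linear (fun m : M => coord W i h *: m).
Proof. by move=> r m m'; rewrite scalerDr !scalerA mulrC. Qed.
Lemma wcoef_lin i : linear (wcoef i).
Proof. exact: tlift_lin. Qed.
HB.instance Definition _ i :=
  GRing.isLinear.Build k (K ⊗ M) M *:%R (wcoef i) (wcoef_lin i).
Lemma wcoef_pure i h m : wcoef i (h ⊠ m) = coord W i h *: m.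
Proof. exact: tlift_pure. Qed.
Lemma wcoefE t : t = \sum_(i < 8) tnth W i ⊠ wcoef i t.
Proof.
rewrite [t]tensorE.
under [RHS]eq_bigr do rewrite linear_sum linear_sumr.
rewrite exchange_big; apply: eq_bigr => p _ /=.
rewrite [in LHS](expandW p.1) (lin_sum (@pure_linl _ _ _ p.2)); apply: eq_bigr => i _.
by rewrite wcoef_pure linearZl_LR linearZr_LR.
Qed.
Lemma wcoef_sum i (m : 'I_8 -> M) : wcoef i (\sum_j tnth W j ⊠ m j) = m i.
Proof.
rewrite linear_sum (bigD1 i) //= wcoef_pure coordW eqxx scale1r big1 ?addr0 // => j ji.
by rewrite wcoef_pure coordW eq_sym (negbTE ji) scale0r.
Qed.
End Coef.

Lemma xi2 : xi * xi = -1. Proof. exact: sqr_prim4 hxi. Qed.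
Lemma xi_neq0 : xi != 0.
Proof.
apply/eqP=> xi_eq0; have := xi2; rewrite xi_eq0 mul0r => /esym/eqP.
by rewrite oppr_eq0 oner_eq0.
Qed.

Section Products.

(* Every word is a scalar multiple of some a^i or some a^i c, and these multiply
   by ca = - xi ac, c^2 = 0 and a^4 = 1. *)
Let m i := a ^+ i.
Let n i := a ^+ i * c.

Let wa : a = m 1. Proof. by rewrite /m expr1. Qed.
Let wc : c = n 0. Proof. by rewrite /n expr0 mul1r. Qed.
Let wb : b = n 2. Proof. by rewrite /n (K_a2c hK). Qed.
Let wd : d = m 3.
Proof. by rewrite /m -[RHS]mulr1 -(K_ad hK) mulrA -exprSr (K_a4 hK) mul1r. Qed.

Let mm i j : m i * m j = m (i + j). Proof. by rewrite /m exprD. Qed.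
Let mn i j : m i * n j = n (i + j). Proof. by rewrite /m /n exprD mulrA. Qed.
Let ca j : c * m j = (- xi) ^+ j *: n j.
Proof.
rewrite /m /n; elim: j => [|j IHj]; first by rewrite !expr0 mulr1 mul1r scale1r.
rewrite exprSr mulrA IHj -scalerAl -!mulrA [c * a](_ : _ = - xi *: (a * c)); last first.
  by rewrite (K_ac hK) scalerA mulNr xi2 opprK scale1r.
by rewrite -scalerAr scalerA -exprSr [a ^+ j * (a * c)]mulrA.
Qed.
Let nm i j : n i * m j = (- xi) ^+ j *: n (i + j).
Proof. by rewrite /n -mulrA ca -scalerAr /n exprD mulrA. Qed.
Let nn i j : n i * n j = 0.
Proof. by rewrite {2}/n mulrA nm -scalerAl /n -mulrA -expr2 (K_c2 hK) mulr0 scaler0. Qed.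
Let m4 i : m i.+4 = m i. Proof. by rewrite /m -addn4 exprD (K_a4 hK) mulr1. Qed.
Let n4 i : n i.+4 = n i. Proof. by rewrite /n -addn4 exprD (K_a4 hK) mulr1. Qed.

Let wE := (mm, mn, nm, nn).

Ltac word_calc :=
  change (a ^+ 2) with (m 2); rewrite ?wb ?wc ?wd ?wa;
  rewrite ?(wE, =^~ scalerAl, =^~ scalerAr, mul0r, mulr0, scaler0) /= ?(m4, n4) ?scalerA;
  first [ by [] | by congr (_ *: _); ring: xi2
    | by rewrite -[RHS]scale1r; congr (_ *: _); ring: xi2
    | by rewrite -[RHS]scaleN1r; congr (_ *: _); ring: xi2 ].

(** The products h_1 n S(h_3) of the compatibility at a and at c, up to the
    scalar in S(c) = - xi c, for n one of a, b, c, d, a^2. *)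
Lemma word_products_ad :
  (a * a * d = a) * (a * b * d = xi *: b) * (a * c * d = xi *: c) *
  (a * d * d = d) * (a * a ^+ 2 * d = a ^+ 2).
Proof. by do !split; word_calc. Qed.
Lemma word_products_bd :
  (b * a * d = b) * (b * b * d = 0) * (b * c * d = 0) *
  (b * d * d = - c) * (b * a ^+ 2 * d = - xi *: (a * b)).
Proof. by do !split; word_calc. Qed.
Lemma word_products_ac :
  (a * a * c = b) * (a * b * c = 0) * (a * c * c = 0) *
  (a * d * c = c) * (a * a ^+ 2 * c = a * b).
Proof. by do !split; word_calc. Qed.
Lemma word_products_bc :
  (b * a * c = 0) * (b * b * c = 0) * (b * c * c = 0) *
  (b * d * c = 0) * (b * a ^+ 2 * c = 0).
Proof. by do !split; word_calc. Qed.
Lemma word_products_cd :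
  (c * a * d = c) * (c * b * d = 0) * (c * c * d = 0) *
  (c * d * d = - b) * (c * a ^+ 2 * d = - xi *: (a * c)).
Proof. by do !split; word_calc. Qed.
Lemma word_products_dd :
  (d * a * d = d) * (d * b * d = xi *: c) * (d * c * d = xi *: b) *
  (d * d * d = a) * (d * a ^+ 2 * d = 1).
Proof. by do !split; word_calc. Qed.
Lemma word_products_cc :
  (c * a * c = 0) * (c * b * c = 0) * (c * c * c = 0) *
  (c * d * c = 0) * (c * a ^+ 2 * c = 0).
Proof. by do !split; word_calc. Qed.
Lemma word_products_dc :
  (d * a * c = c) * (d * b * c = 0) * (d * c * c = 0) *
  (d * d * c = b) * (d * a ^+ 2 * c = a * c).
Proof. by do !split; word_calc. Qed.
Definition word_products :=
  (word_products_ad, word_products_bd, word_products_ac, word_products_bc,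
   word_products_cd, word_products_dd, word_products_cc, word_products_dc).

Lemma comul_a2 : comul (a ^+ 2) = a ^+ 2 ⊠ a ^+ 2.
Proof.
rewrite expr2 (hopf_comulM (hopfP K)) (K_comul_a hK) tensmulDl !tensmulDr !tensmul_pure.
rewrite -[b * b]expr2 (K_b2 hK) (lin0 (pure_linl _)) addr0 -expr2.
have -> : b * a = - xi *: (a * b) by word_calc.
have -> : c * a = - xi *: (a * c) by word_calc.
rewrite (lin_scale (pure_linl _)) (lin_scale (pure_linr _)) scalerA.
by rewrite mulrNN xi2 scaleN1r addrK.
Qed.

Lemma comul_ab : comul (a * b) = (a * b) ⊠ 1 + a ^+ 2 ⊠ (a * b).
Proof.
rewrite (hopf_comulM (hopfP K)) (K_comul_a hK) (K_comul_b hK).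
rewrite tensmulDl !tensmulDr !tensmul_pure.
rewrite (K_cb hK) (lin0 (pure_linr _)) -[b * b]expr2 (K_b2 hK) (lin0 (pure_linl _)).
by rewrite !addr0 (K_ad hK) -expr2 addrC.
Qed.

Lemma comul_ac : comul (a * c) = (a * c) ⊠ a ^+ 2 + 1 ⊠ (a * c).
Proof.
rewrite (hopf_comulM (hopfP K)) (K_comul_a hK) (K_comul_c hK).
rewrite tensmulDl !tensmulDr !tensmul_pure.
rewrite (K_bc hK) (lin0 (pure_linl _)) -[c * c]expr2 (K_c2 hK) (lin0 (pure_linr _)).
by rewrite !addr0 (K_ad hK) -expr2.
Qed.

End Products.

(** * The coefficient operators of a Yetter-Drinfeld module *)

Variable V : ydMod K.
Notation yV := (yd_data V).

Definition op (i : 'I_8) (v : V) : V := wcoef i (coact yV v).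
Lemma op_lin i : linear (op i).
Proof. by move=> r u v; rewrite /op (yd_coact_linear (ydP V)) linearP. Qed.
HB.instance Definition _ i := GRing.isLinear.Build k V V *:%R (op i) (op_lin i).

Notation P := (op o0).
Notation A := (op o1).
Notation B := (op o2).
Notation C := (op o3).
Notation D := (op o4).
Notation Q := (op o5).
Notation Y := (op o6).
Notation X := (op o7).

Lemma coact_sum v : coact yV v = \sum_i tnth W i ⊠ op i v.
Proof. exact: wcoefE. Qed.

Lemma coactE v : coact yV v = 1 ⊠ P v + a ⊠ A v + b ⊠ B v + c ⊠ C v + d ⊠ D v +
  a ^+ 2 ⊠ Q v + (a * b) ⊠ Y v + (a * c) ⊠ X v.
Proof. by rewrite coact_sum sum8. Qed.

Lemma coact_op i v :
  coact yV (op i v) = wcoef i (tassoc (tmap (@comul k K) id (coact yV v))).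
Proof.
rewrite (yd_coassoc (ydP V)) (coact_sum v) (lin_sum (tmap_lin _ _)) //; last first.
  exact: yd_coact_linear (ydP V).
rewrite -(wcoef_sum i (fun j => coact yV (op j v))); congr (wcoef _ _).
by apply: eq_bigr => j _; rewrite tmap_pure //; exact: yd_coact_linear (ydP V).
Qed.

Let DL := coalg_comul_linear (hopf_coalgebra (hopfP K)).

Lemma coact_op_sum i v : coact yV (op i v) =
  \sum_j wcoef i (tassoc (comul (tnth W j) ⊠ op j v)).
Proof.
rewrite coact_op (coact_sum v) (lin_sum (tmap_lin DL (@linear_id _ _))).
rewrite (lin_sum (@tassoc_lin _ _ _ _)) linear_sum; apply: eq_bigr => j _.
by rewrite tmap_pure.
Qed.

Lemma wcoef_tassoc_comul2 i h x1 x2 x3 x4 (v : V) :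
  comul h = x1 ⊠ x2 + x3 ⊠ x4 ->
  wcoef i (tassoc (comul h ⊠ v)) =
  coord W i x1 *: (x2 ⊠ v) + coord W i x3 *: (x4 ⊠ v).
Proof.
move=> ->; rewrite (lin_add (pure_linl _)) (lin_add (@tassoc_lin _ _ _ _)) linearD.
by rewrite !tassoc_pure /= !wcoef_pure.
Qed.

Lemma wcoef_tassoc_comul1 i h x1 x2 (v : V) :
  comul h = x1 ⊠ x2 ->
  wcoef i (tassoc (comul h ⊠ v)) = coord W i x1 *: (x2 ⊠ v).
Proof. by move=> ->; rewrite tassoc_pure wcoef_pure. Qed.

(** Coassociativity, read off along the i-th word in the first tensor factor:
    1, ac, a^2, ab span a copy of Sweedler's Hopf algebra, and a, b, c, d
    span a 2 x 2 matrix coalgebra. *)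
Lemma coact_opE i v : coact yV (op i v) =
  (i == o0)%:R *: (1 ⊠ P v + (a * c) ⊠ X v) +
  (i == o1)%:R *: (a ⊠ A v + b ⊠ B v) +
  (i == o2)%:R *: (c ⊠ A v + d ⊠ B v) +
  (i == o3)%:R *: (a ⊠ C v + b ⊠ D v) +
  (i == o4)%:R *: (c ⊠ C v + d ⊠ D v) +
  (i == o5)%:R *: (a ^+ 2 ⊠ Q v + (a * b) ⊠ Y v) +
  (i == o6)%:R *: (1 ⊠ Y v) + (i == o7)%:R *: (a ^+ 2 ⊠ X v).
Proof.
rewrite coact_op_sum sum8.
rewrite (wcoef_tassoc_comul1 _ _ (hopf_comul1 (hopfP K))).
rewrite (wcoef_tassoc_comul2 _ _ (K_comul_a hK)) (wcoef_tassoc_comul2 _ _ (K_comul_b hK)).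
rewrite (wcoef_tassoc_comul2 _ _ (K_comul_c hK)) (wcoef_tassoc_comul2 _ _ (K_comul_d hK)).
rewrite (wcoef_tassoc_comul1 _ _ comul_a2) (wcoef_tassoc_comul2 _ _ comul_ab).
rewrite (wcoef_tassoc_comul2 _ _ comul_ac) !coord_words.
by case: i => [[|[|[|[|[|[|[|[|i]]]]]]]]] //= lti;
  rewrite ?scale0r ?scale1r ?addr0 ?add0r // addrC.
Qed.

Lemma op_opE j i v : op j (op i v) =
  (i == o0)%:R *: ((j == o0)%:R *: P v + (j == o7)%:R *: X v) +
  (i == o1)%:R *: ((j == o1)%:R *: A v + (j == o2)%:R *: B v) +
  (i == o2)%:R *: ((j == o3)%:R *: A v + (j == o4)%:R *: B v) +
  (i == o3)%:R *: ((j == o1)%:R *: C v + (j == o2)%:R *: D v) +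
  (i == o4)%:R *: ((j == o3)%:R *: C v + (j == o4)%:R *: D v) +
  (i == o5)%:R *: ((j == o5)%:R *: Q v + (j == o6)%:R *: Y v) +
  (i == o6)%:R *: ((j == o0)%:R *: Y v) + (i == o7)%:R *: ((j == o5)%:R *: X v).
Proof.
rewrite -[LHS]/(wcoef j (coact yV (op i v))) coact_opE.
set rhs := RHS.
by rewrite !linearD /= !linearZ /= !wcoef_pure !coord_words /rhs !scalerDr.
Qed.

Lemma counit_op v : v = P v + A v + D v + Q v.
Proof.
have hC := hopf_coalgebra (hopfP K).
rewrite -[LHS](yd_counit (ydP V)) coact_sum tlift_sum_pure; first last.
- by move=> h r u w; rewrite scalerDr !scalerA mulrC.
- by move=> u r h h'; rewrite (coalg_counit_linear hC) scalerDl scalerA.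
rewrite sum8 /= (hopf_counit1 (hopfP K)) !(hopf_counitM (hopfP K)).
rewrite (K_counit_a hK) (K_counit_b hK) (K_counit_c hK) (K_counit_d hK) !mulr0 !mulr1.
by rewrite !scale0r !scale1r !addr0.
Qed.

Local Ltac op_calc :=
  rewrite ?op_opE /= ?(scale0r, scale1r, addr0, add0r).

(** * Subobjects, idempotent endomorphisms and isomorphisms *)

Lemma act_mul g h v : act yV (g * h) v = act yV g (act yV h v).
Proof. exact: (yd_actM (ydP V)). Qed.

Lemma act_b v : act yV b v = act yV a (act yV a (act yV c v)).
Proof. by rewrite -(K_a2c hK) expr2 !act_mul. Qed.

Lemma act_a4 v : act yV a (act yV a (act yV a (act yV a v))) = v.
Proof.
by rewrite -[RHS](yd_act1 (ydP V)) -(K_a4 hK) !exprS expr0 mulr1 !act_mul.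
Qed.

Lemma act_d v : act yV d v = act yV a (act yV a (act yV a v)).
Proof.
by rewrite -[LHS]act_a4 -(act_mul a d) (K_ad hK) (yd_act1 (ydP V)).
Qed.

Lemma act_ac v : act yV a (act yV c v) = xi *: act yV c (act yV a v).
Proof. by rewrite -!act_mul (K_ac hK) (lin_scale (yd_act_linearl (ydP V) v)). Qed.

Lemma act_cc v : act yV c (act yV c v) = 0.
Proof. by rewrite -act_mul -expr2 (K_c2 hK) (lin0 (yd_act_linearl (ydP V) v)). Qed.

Lemma act_sum h v : act yV h v = \sum_(i < 8) coord W i h *: act yV (tnth W i) v.
Proof.
have aL := yd_act_linearl (ydP V) v.
by rewrite [in LHS](expandW h) (lin_sum aL); apply: eq_bigr => i _;
  rewrite (lin_scale aL).
Qed.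

(** It suffices to test a and c for the action, since b = a^2 c and d = a^3. *)
Lemma yd_sub_of_ops (S : {pred V}) : submod_closed S ->
  (forall v, v \in S -> act yV a v \in S) -> (forall v, v \in S -> act yV c v \in S) ->
  (forall i v, v \in S -> op i v \in S) -> yd_sub yV S.
Proof.
move=> Ssub Sa Sc Sop; split=> // [h v Sv|v Sv].
  have [S0 Slin] := Ssub.
  have Sd w : w \in S -> act yV d w \in S by move=> Sw; rewrite act_d !Sa.
  have Sb w : w \in S -> act yV b w \in S by move=> Sw; rewrite act_b !(Sa, Sc).
  rewrite act_sum; elim/big_rec: _ => // i w _; apply: Slin.
  case: i => [[|[|[|[|[|[|[|[|i]]]]]]]]] //= lti; rewrite /tnth /= ?expr2 ?act_mul;
    by rewrite ?(yd_act1 (ydP V)) ?(Sa, Sb, Sc, Sd).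
exists [seq (tnth W i, op i v) | i <- index_enum 'I_8].
  by apply/allP => _ /mapP[i _ ->]; rewrite /= Sop.
by rewrite big_map coact_sum.
Qed.

(** Coefficients along a basis of K can be taken in any expression of the
    coaction as a tensor over S. *)
Lemma op_sub (S : {pred V}) i v : yd_sub yV S -> v \in S -> op i v \in S.
Proof.
move=> [[S0 Slin] _ Sco] Sv; rewrite -[op i v]/(wcoef i (coact yV v)).
have [s /allP sS ->] := Sco v Sv.
rewrite linear_sum big_seq; elim/big_rec: _ => // p w /sS /andP[_ Sp] Sw.
by rewrite /= wcoef_pure Slin.
Qed.

(** The image and the kernel of e are complementary subobjects. *)
Lemma idempotent_endomorphism (e : V -> V) : yd_indecomposable V -> linear e ->
  (forall v, e (e v) = e v) ->
  (forall v, e (act yV a v) = act yV a (e v)) ->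
  (forall v, e (act yV c v) = act yV c (e v)) ->
  (forall i v, e (op i v) = op i (e v)) ->
  (exists v, e v != 0) -> forall v, e v = v.
Proof.
move=> [_ indec] eL ee ea ec eop [v0 nz_ev0].
pose S := [pred v | e v == v]; pose T := [pred v | e v == 0].
have subS : yd_sub yV S.
  apply: yd_sub_of_ops => [||v|i v]; last 1 first.
  - by rewrite !inE => /eqP ev; rewrite eop ev.
  - split=> [|r v w]; first by rewrite inE (lin0 eL).
    by rewrite !inE eL => /eqP-> /eqP->.
  - by move=> v; rewrite !inE ea => /eqP->.
  by rewrite !inE ec => /eqP->.
have subT : yd_sub yV T.
  apply: yd_sub_of_ops => [||v|i v]; last 1 first.
  - by rewrite !inE => /eqP ev; rewrite eop ev linear0.
  - split=> [|r v w]; first by rewrite inE (lin0 eL).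
    by rewrite !inE eL => /eqP-> /eqP->; rewrite scaler0 addr0.
  - by move=> v; rewrite !inE ea => /eqP->; rewrite linear0.
  by rewrite !inE ec => /eqP->; rewrite linear0.
case: (indec S T subS subT) => [v|v|S0|T0].
- exists (e v), (v - e v); rewrite !inE (lin_sub eL) !ee subrr !eqxx.
  by split=> //; rewrite addrC subrK.
- by rewrite !inE => /eqP-> /eqP.
- by case/eqP: nz_ev0; apply: S0; rewrite inE ee.
move=> v; apply/eqP; rewrite eq_sym -subr_eq0; apply/eqP/T0.
by rewrite inE (lin_sub eL) ee subrr.
Qed.

Section Iso.
Variables (n : nat) (Ma Mb Mc Md : 'M[k]_n.+1) (cf : 'cV[k]_n.+1 -> K ⊗ 'cV[k]_n.+1).
Variable g : V -> 'cV[k]_n.+1.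
Lemma yd_iso_Kact : linear g -> bijective g ->
  (forall v, g (act yV a v) = Ma *m g v) -> (forall v, g (act yV b v) = Mb *m g v) ->
  (forall v, g (act yV c v) = Mc *m g v) -> (forall v, g (act yV d v) = Md *m g v) ->
  (forall v, cf (g v) = \sum_(i < 8) tnth W i ⊠ g (op i v)) ->
  yd_iso yV (YDData (Kact a b c d Ma Mb Mc Md) cf).
Proof.
move=> gL gB ga gb gc gd gco; exists g; split=> //; split=> // [h v|v] /=.
  rewrite /Kact act_sum (lin_sum gL) mulmx_suml; apply: eq_bigr => i _.
  rewrite (lin_scale gL) -scalemxAl; congr (_ *: _).
  case: i => [[|[|[|[|[|[|[|[|i]]]]]]]]] //= lti; rewrite /tnth /=.
  - by rewrite (yd_act1 (ydP V)) mul1mx.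
  - by rewrite !expr2 act_mul !ga mulmxA.
  - by rewrite act_mul ga gb mulmxA.
  by rewrite act_mul ga gc mulmxA.
rewrite gco [coact _ v]coact_sum (lin_sum (tmap_lin _ gL)) //.
by apply: eq_bigr => i _; rewrite tmap_pure.
Qed.
End Iso.

(** * The coefficients along 1, ab and ac vanish *)

Hypotheses (hchar : [pchar k] =i pred0) (hVfin : finite_dim V).
Variables (R : gradedBraidedHopf K).
Hypotheses (hR : is_nichols V R) (hRfin : finite_dim R).

Lemma functional_criterion_op (f : V -> k^o) v : linear f -> f v != 0 ->
  (forall u w, \sum_i f (op i u) * f (act yV (tnth W i) w) = f u * f w) -> False.
Proof.
move=> fL fv f_mult; apply: (functional_criterion hR hchar hRfin fL fv) => u w.
rewrite coact_sum tlift_sum_pure // => [m|h] r x y.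
  by rewrite (yd_act_linearl (ydP V)) fL mulrDr /GRing.scale /= mulrCA.
by rewrite fL mulrDl /GRing.scale /= mulrA.
Qed.

(** If u = P u is nonzero and X u = 0, then delta(u) = 1 (x) u and the braiding
    fixes u (x) u.  Otherwise X is injective on the image of P; since Y takes its
    values in the image of P and X Y = 0, this forces Y = 0, and then a functional
    composed with P sees only the coefficient along 1 of the coaction. *)
Lemma op_P0 v : P v = 0.
Proof.
have [//|nz_Pv] := eqVneq (P v) 0; exfalso.
have [[u [nz_u PXu]]|injX] := pselect (exists u, P u != 0 /\ X (P u) = 0).
  apply: (vector_criterion hR hchar hVfin hRfin nz_u).
  rewrite (@braiding_sum _ _ _ _ (ydP V) [:: (1, P u)]); last first.
    have Xu : X u = 0 by move: PXu; op_calc.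
    by rewrite big_seq1 coact_opE /= Xu (lin0 (pure_linr _)); op_calc.
  by rewrite big_seq1 /= (yd_act1 (ydP V)).
have op_Y0 w : Y w = 0.
  have PYw : P (Y w) = Y w by op_calc.
  have [//|nz_Yw] := eqVneq (Y w) 0; case: injX.
  by exists (Y w); rewrite PYw; split=> //; op_calc.
have [f fL fPv] := finite_dim_functional hVfin nz_Pv.
apply: (@functional_criterion_op (fun u => f (P u)) (P v)).
- by move=> r x y; rewrite linearP fL.
- by rewrite (_ : P (P v) = P v) ?fPv ?oner_neq0 //; op_calc.
move=> u w; rewrite sum8; op_calc.
rewrite op_Y0 (lin0 fL) !mul0r !addr0 (_ : tnth W o0 = 1) //.
by rewrite (yd_act1 (ydP V)).
Qed.

Lemma op_X0 v : X v = 0.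
Proof.
by have := op_opE o7 o0 v; rewrite op_P0 linear0 /=
  ?(scale0r, scale1r, addr0, add0r). Qed.
Lemma op_Y0 v : Y v = 0.
Proof.
by have := op_opE o0 o6 v; rewrite !op_P0 /= ?(scale0r, scale1r, addr0, add0r). Qed.

(** * The compatibility at a and c *)

Lemma coact5 v : coact yV v =
  \sum_(p <- [:: (a, A v); (b, B v); (c, C v); (d, D v); (a ^+ 2, Q v)]) p.1 ⊠ p.2.
Proof.
rewrite !big_cons big_nil coactE op_P0 op_X0 op_Y0.
by rewrite !(lin0 (pure_linr _)) add0r !addr0 !addrA.
Qed.

Local Ltac compat_calc v dh d1 d2 :=
  rewrite (coact_act v dh d1 d2)
    !(compat_term_sum _ _ _ (coact5 v)) !big_cons !big_nil /=
    ?(K_antipode_a hK) ?(K_antipode_c hK) -!scalerAr !word_products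
    ?scaler0 !(lin0 (pure_linl _)) ?addr0 ?add0r !linearD /= !wcoef_pure
    ?(linearZ, linearN) /= !coord_words /=
    ?(mulr0, mulr1, oppr0, scale0r, scale1r, addr0, add0r, scaleNr, scaleN1r).
Local Ltac compat_a v := compat_calc v (K_comul_a hK) (K_comul_a hK) (K_comul_b hK).
Local Ltac compat_c v := compat_calc v (K_comul_c hK) (K_comul_c hK) (K_comul_d hK).

Lemma A_act_a v : A (act yV a v) = act yV a (A v).
Proof. by rewrite -[LHS]/(wcoef o1 (coact yV (act yV a v))); compat_a v. Qed.

Lemma B_act_a v : B (act yV a v) =
  xi *: act yV a (B v) + act yV c (A v) - xi *: act yV b (A v).
Proof. by rewrite -[LHS]/(wcoef o2 (coact yV (act yV a v))); compat_a v; rewrite scalerN. Qed.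

Lemma C_act_a v : C (act yV a v) =
  xi *: act yV a (C v) - act yV c (D v) - xi *: act yV b (D v).
Proof. by rewrite -[LHS]/(wcoef o3 (coact yV (act yV a v))); compat_a v; rewrite scalerN. Qed.

Lemma D_act_a v : D (act yV a v) = act yV a (D v).
Proof. by rewrite -[LHS]/(wcoef o4 (coact yV (act yV a v))); compat_a v. Qed.

Lemma Q_act_a v : Q (act yV a v) = act yV a (Q v).
Proof. by rewrite -[LHS]/(wcoef o5 (coact yV (act yV a v))); compat_a v. Qed.

(** On the image of Q, the coefficient along 1 of the coaction of c v is c v
    itself, and the coefficient along ac is - xi (a + d) v. *)
Lemma act_c_Q v : act yV c (Q v) = 0.
Proof.
rewrite -(op_P0 (act yV c v)).
by rewrite -[RHS]/(wcoef o0 (coact yV (act yV c v))); compat_c v.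
Qed.

Lemma act_ad_Q v : act yV a (Q v) + act yV d (Q v) = 0.
Proof.
have : X (act yV c v) = 0 by apply: op_X0.
rewrite -[LHS]/(wcoef o7 (coact yV (act yV c v))); compat_c v.
move/eqP; rewrite -opprD -scalerDr oppr_eq0 scaler_eq0 (negbTE xi_neq0).
by move/eqP.
Qed.

Lemma Q_act_c v : Q (act yV c v) = 0.
Proof. by rewrite -[LHS]/(wcoef o5 (coact yV (act yV c v))); compat_c v. Qed.

Lemma A_act_c v : A (act yV c v) = act yV c (D v).
Proof. by rewrite -[LHS]/(wcoef o1 (coact yV (act yV c v))); compat_c v. Qed.

Lemma D_act_c v : D (act yV c v) = act yV c (A v).
Proof. by rewrite -[LHS]/(wcoef o4 (coact yV (act yV c v))); compat_c v. Qed.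

Lemma B_act_c v : B (act yV c v) =
  xi *: act yV c (C v) - act yV a (D v) - xi *: act yV d (D v).
Proof.
by rewrite -[LHS]/(wcoef o2 (coact yV (act yV c v))); compat_c v;
  rewrite scalerN [- _ + _]addrC.
Qed.

Lemma C_act_c v : C (act yV c v) =
  act yV a (A v) + xi *: act yV c (B v) - xi *: act yV d (A v).
Proof. by rewrite -[LHS]/(wcoef o3 (coact yV (act yV c v))); compat_c v; rewrite scalerN. Qed.

Hypothesis hVind : yd_indecomposable V.

Let two_neq0 : (2%:R : k) != 0. Proof. exact: (natr_neq0 hchar 1). Qed.

(** * The part of V with coaction along a^2 *)

Section OneDim.
Variable v0 : V.
Hypothesis Qv0 : Q v0 != 0.

Let aaQ v : act yV a (act yV a (Q v)) = - Q v.
Proof.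
have := congr1 (act yV a) (act_ad_Q v).
rewrite linearD linear0 /= act_d act_a4 => /eqP.
by rewrite addr_eq0 => /eqP.
Qed.

(** Every vector of the image of Q spans a subcomodule and is killed by b and c,
    so an eigenvector of a there spans a subobject.  It has the complement
    Ker f, where f is chosen to be an eigenvector of the transpose of a. *)
Lemma onedim_structure : exists eta u (f : V -> k^o),
  [/\ eta ^+ 2 = -1, linear f, f u = 1, forall v, v = f v *: u &
     [/\ Q u = u, act yV a u = eta *: u & act yV c u = 0]].
Proof.
have aL h : linear (act yV h) := yd_act_linearr (ydP V) h.
have QQ v : Q (Q v) = Q v by op_calc.
have Qa := Q_act_a.
have [|eta [u [eta2 nz_u au u_def]]] := eigenvector_of_square (aL a) Qv0 (s := xi).
  by rewrite aaQ expr2 xi2 scaleN1r.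
have eta_neq0 : eta != 0 by rewrite -sqrf_eq0 eta2 sqrf_eq0 xi_neq0.
have eta2' : eta ^+ 2 = -1 by rewrite eta2 expr2 xi2.
have Qu : Q u = u.
  by case: u_def => ->; rewrite ?linearD ?linearZ /= ?Qa QQ.
have [f0 f0L f0u] := finite_dim_functional hVfin nz_u.
pose f1 w := f0 (Q w).
have f1L : linear f1 by move=> r x y; rewrite /f1 linearP f0L.
pose f := halve (act yV a) f1 eta.
have fL : linear f := halve_lin (aL a) eta f1L.
have fa w : f (act yV a w) = eta * f w.
  by apply: halve_eigen; rewrite /f1 !Qa aaQ eta2' (lin_opp f0L) mulN1r.
have fQ w : f (Q w) = f w by rewrite /f /halve /f1 !Qa !QQ.
have fu : f u = 1.
  by rewrite /f (halve_id two_neq0 f1L eta_neq0 au) /f1 Qu.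
have cu : act yV c u = 0 by rewrite -Qu act_c_Q.
have fc w : f (act yV c w) = 0.
  by rewrite -fQ Q_act_c (lin0 fL).
clearbody f.
have e_id : forall v, f v *: u = v.
  apply: (idempotent_endomorphism (e := fun v => f v *: u) hVind).
  - exact: functional_scale_lin.
  - by move=> v; rewrite (lin_scale fL) fu /GRing.scale /= mulr1.
  - by move=> v; rewrite fa linearZ /= au scalerA mulrC.
  - by move=> v; rewrite fc scale0r linearZ /= cu scaler0.
  - move=> i v; rewrite linearZ /= -[in RHS]Qu -fQ.
    case: i => [[|[|[|[|[|[|[|[|i]]]]]]]]] //= lti; op_calc;
      by rewrite ?op_X0 ?op_Y0 ?(lin0 fL) ?scaler0 ?scale0r ?fQ ?Qu.
  by exists u; rewrite fu scale1r.
by exists eta, u, f; split.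
Qed.

(** Since a^2 = -1 on V, the eigenvalue of a is xi or xi^3, and the coaction of
    either object is through a^2 = a^6. *)
Lemma onedim_case : yd_simple V /\
  (yd_iso V (onedim xi a b c d 1) \/ yd_iso V (onedim xi a b c d 3)).
Proof.
have [eta [u [f [eta2 fL fu Vu [Qu au cu]]]]] := onedim_structure.
split.
  split; first by case: hVind.
  move=> S [[S0 Slin] _ _]; have [Su|nSu] := boolP (u \in S); [right|left].
    by move=> v; rewrite (Vu v) -[_ *: _]addr0 Slin.
  move=> v Sv; rewrite (Vu v); have [->|nz] := eqVneq (f v) 0; first by rewrite scale0r.
  case/negP: nSu; rewrite (_ : u = (f v)^-1 *: v + 0) ?Slin // addr0.
  by rewrite {2}(Vu v) scalerA mulVf // scale1r.
have eta_cases : eta = xi ^+ 1 \/ eta = xi ^+ 3.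
  have /eqP : eta ^+ 2 = xi ^+ 2 by rewrite eta2 expr2 xi2.
  rewrite eqf_sqr => /orP[] /eqP ->; [by left|right].
  by rewrite !exprS expr0 mulr1 mulrA xi2 mulN1r.
pose g v : 'cV[k]_1 := (f v)%:M.
have key j : eta = xi ^+ j -> a ^+ (2 * j) = a ^+ 2 -> yd_iso V (onedim xi a b c d j).
  move=> eta_j a2j.
  have eta3 : eta * eta * eta = eta^-1.
    have nz_eta : eta != 0 by rewrite eta_j expf_neq0 ?xi_neq0.
    by apply: (mulfI nz_eta); rewrite divff // -!mulrA -expr2 mulrA -expr2
      eta2 mulrNN mulr1.
  rewrite /onedim; apply: (@yd_iso_Kact 0 _ _ _ _ _ g).
  - by move=> r x y; rewrite /g fL raddfD /= scale_scalar_mx.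
  - exists (fun x : 'cV[k]_1 => x 0 0 *: u) => [v|x].
      by rewrite mxE eqxx mulr1n -Vu.
    by rewrite /g (lin_scale fL) fu /GRing.scale /= mulr1 -mx11_scalar.
  - move=> v; rewrite /g [in LHS](Vu v) linearZ /= au scalerA (lin_scale fL) fu.
    by rewrite -scalar_mxM /GRing.scale /= mulr1 mulrC -eta_j.
  - move=> v; rewrite /g [in LHS](Vu v) linearZ /= act_b cu !linear0 (lin0 fL).
    by rewrite mul0mx -[RHS](@raddf0 _ _ (@scalar_mx k 1)).
  - move=> v; rewrite /g [in LHS](Vu v) linearZ /= cu !linear0 (lin0 fL).
    by rewrite mul0mx -[RHS](@raddf0 _ _ (@scalar_mx k 1)).
  - move=> v; rewrite /g [in LHS](Vu v) linearZ /= act_d au !linearZ /= au !linearZ /= au.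
    rewrite !scalerA (lin_scale fL) fu -scalar_mxM /GRing.scale /= mulr1 -eta_j.
    by rewrite -eta3; congr (_%:M); ring.
  have hQ v : Q v = v by rewrite (Vu v) linearZ /= Qu.
  have g0 : g 0 = 0 by rewrite /g (lin0 fL) -[RHS](@raddf0 _ _ (@scalar_mx k 1)).
  move=> v; rewrite -(hQ v) sum8; op_calc; rewrite op_Y0 g0 a2j.
  by rewrite !(lin0 (pure_linr _)) !addr0 !add0r.
case: eta_cases => eta_j; [left|right]; apply: key => //.
by rewrite (exprD _ 4 2) (K_a4 hK) mul1r.
Qed.
End OneDim.

(** * The part of V over the matrix coalgebra *)

Notation al := (act yV a).
Notation ch := (act yV c).
(** The action of a on the image of D, transported to the image of A by the
    bijection B. *)
Definition beta (v : V) : V := C (al (B v)).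
(** The action of c exchanges the images of A and D; p_op and q_op are its two
    components, read on the image of A. *)
Definition p_op (v : V) : V := C (ch (A v)).
Definition q_op (v : V) : V := ch (B v).
Lemma beta_lin : linear beta. Proof. by move=> r v w; rewrite /beta !linearP. Qed.
Lemma p_op_lin : linear p_op. Proof. by move=> r v w; rewrite /p_op !linearP. Qed.
Lemma q_op_lin : linear q_op. Proof. by move=> r v w; rewrite /q_op !linearP. Qed.
HB.instance Definition _ := GRing.isLinear.Build k V V *:%R beta beta_lin.
HB.instance Definition _ := GRing.isLinear.Build k V V *:%R p_op p_op_lin.
HB.instance Definition _ := GRing.isLinear.Build k V V *:%R q_op q_op_lin.

Lemma op_BC v : B (C v) = D v. Proof. by op_calc. Qed.
Lemma op_CB v : C (B v) = A v. Proof. by op_calc. Qed.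
Lemma op_DB v : D (B v) = B v. Proof. by op_calc. Qed.
Lemma op_CA v : C (A v) = 0. Proof. by op_calc. Qed.
Lemma op_AB v : A (B v) = 0. Proof. by op_calc. Qed.
Lemma op_AC v : A (C v) = C v. Proof. by op_calc. Qed.
Lemma op_AA v : A (A v) = A v. Proof. by op_calc. Qed.

Lemma al_A v : A (al v) = al (A v). Proof. by rewrite A_act_a. Qed.
Lemma al_D v : D (al v) = al (D v). Proof. by rewrite D_act_a. Qed.

Lemma al_B v : al (B v) = B (beta v).
Proof. by rewrite /beta op_BC al_D op_DB. Qed.
Lemma A_beta v : A (beta v) = beta v. Proof. exact: op_AC. Qed.
Lemma A_p_op v : A (p_op v) = p_op v. Proof. exact: op_AC. Qed.
Lemma A_q_op v : A (q_op v) = q_op v.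
Proof. by rewrite /q_op A_act_c op_DB. Qed.
Lemma ch_A v : ch (A v) = B (p_op v).
Proof. by rewrite /p_op op_BC D_act_c op_AA. Qed.

Section OnU.
Variable u : V.
Hypothesis Au : A u = u.

(** Compatibility at a, on the image of A and then on that of D
    ([q_op_of_beta]). *)
Lemma al_of_p_op : al u = xi *: beta u + p_op u - xi *: beta (beta (p_op u)).
Proof.
have := congr1 C (B_act_a u).
rewrite op_CB al_A Au => ->; rewrite linearB linearD !linearZ /= act_b.
by rewrite -[in ch u]Au ch_A !al_B op_CB A_beta op_CB A_p_op op_CB A_beta.
Qed.

Lemma q_op_of_beta : q_op u + xi *: al (al (q_op u)) = xi *: al u - beta u.
Proof.
rewrite /beta (C_act_a (B u)) op_CB op_DB Au act_b -/(q_op u).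
by rewrite -addrA -opprD opprB addrCA subrr addr0.
Qed.

(** Compatibility at c, on the image of A and then on that of D
    ([q_op_of_p_op]). *)
Lemma p_op_of_q_op : p_op u = al u + xi *: q_op u - xi *: al (al (al u)).
Proof.
by rewrite /p_op Au (C_act_c u) Au act_d.
Qed.

Lemma q_op_of_p_op : q_op u = xi *: p_op u - beta u - xi *: beta (beta (beta u)).
Proof.
have := congr1 C (B_act_c (B u)).
rewrite op_CB -/(q_op u) A_q_op => ->; rewrite !linearB !linearZ /= act_d op_CB op_DB Au.
by rewrite -[in ch u]Au ch_A op_CB A_p_op !al_B op_CB A_beta op_CB A_beta.
Qed.

Lemma al_q_op : al (q_op u) = xi *: q_op (beta u).
Proof. by rewrite /q_op act_ac al_B. Qed.

Lemma q_op_p_op : q_op (p_op u) = 0.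
Proof. by rewrite /q_op -ch_A act_cc. Qed.

End OnU.

(** Put N = xi a - beta, which is (1 + xi a^2) q_op by [q_op_of_beta].  As
    a q_op = xi q_op beta, also a N = xi N beta, and expanding N gives the claim. *)
Lemma al_sqr u : A u = u -> al (al u) = - beta (beta u).
Proof.
move=> Au.
have Ab : A (beta u) = beta u by exact: A_beta.
have : al (xi *: al u - beta u) = xi *: (xi *: al (beta u) - beta (beta u)).
  rewrite -(q_op_of_beta Au) -(q_op_of_beta Ab) linearD linearZ /= al_q_op !linearZ /= scalerDr.
  by rewrite !scalerA.
rewrite linearB linearZ /= scalerBr scalerA xi2 scaleN1r.
rewrite [LHS]addrC => /addrI /(congr1 (fun w => (- xi) *: w)).
by rewrite scalerN !scalerA !mulNr xi2 opprK !scale1r => ->.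
Qed.

(** Solve the linear system [p_op_of_q_op], [q_op_of_p_op] for p_op and q_op. *)
Lemma p_op_double u : A u = u ->
  2%:R *: p_op u = al u - xi *: al (al (al u)) - xi *: beta u + beta (beta (beta u)).
Proof.
move=> Au; rewrite scaler_nat mulr2n {1}(p_op_of_q_op Au) (q_op_of_p_op Au)
  !scalerBr !scalerA xi2 !scaleN1r opprK.
by rewrite ?addrA (ACl (1*5*3*4*6*2)) /= addrK.
Qed.

Lemma q_op_double u : A u = u ->
  2%:R *: q_op u = xi *: al u + al (al (al u)) - beta u - xi *: beta (beta (beta u)).
Proof.
move=> Au; rewrite scaler_nat mulr2n {1}(q_op_of_p_op Au) (p_op_of_q_op Au)
  !scalerBr !scalerDr !scalerA xi2 !scaleN1r opprK.
by rewrite ?addrA (ACl (1*3*4*5*6*2)) /= addrK.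
Qed.

(** N = xi a - beta kills the image of p_op because q_op p_op = c^2 = 0.  It
    commutes with a^2 = - beta^2, so it also kills (a - xi beta) u, which is
    (1 + xi a^2) p_op u by [al_of_p_op].  Expanding N (a - xi beta) = 0 leaves the
    commutator of a and beta. *)
Lemma al_beta u : A u = u -> al (beta u) = beta (al u).
Proof.
move=> Au.
have Ab : A (beta u) = beta u by exact: A_beta.
have Ap : A (p_op u) = p_op u by exact: A_p_op.
have Np : xi *: al (p_op u) = beta (p_op u).
  apply/eqP; by rewrite -subr_eq0 -(q_op_of_beta Ap) q_op_p_op !linear0 addr0.
have Naap : xi *: al (al (al (p_op u))) = beta (al (al (p_op u))).
  have -> : beta (al (al (p_op u))) = al (al (beta (p_op u))).
    by rewrite (al_sqr Ap) (al_sqr (A_beta _)) linearN.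
  by rewrite -Np !linearZ.
have M : al u - xi *: beta u = p_op u + xi *: al (al (p_op u)).
  rewrite {1}(al_of_p_op Au) (al_sqr Ap) scalerN.
  by rewrite ?addrA (ACl (2*3*1*4)) /= addrK.
have : xi *: al (al u - xi *: beta u) = beta (al u - xi *: beta u).
  by rewrite M !linearD !linearZ /= scalerA mulrC -scalerA Naap Np.
rewrite !linearB !linearZ /= scalerA xi2 scaleN1r opprK (al_sqr Au) scalerN addrC.
by move/addIr.
Qed.

Lemma op_BA v : B (A v) = B v. Proof. by op_calc. Qed.
Lemma op_AD v : A (D v) = 0. Proof. by op_calc. Qed.
Lemma beta_A v : beta (A v) = beta v. Proof. by rewrite /beta op_BA. Qed.
Lemma p_op_A v : p_op (A v) = p_op v. Proof. by rewrite /p_op op_AA. Qed.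
Lemma q_op_A v : q_op (A v) = q_op v. Proof. by rewrite /q_op op_BA. Qed.

Hypothesis Q0 : forall v, Q v = 0.

Lemma split_AD v : v = A v + D v.
Proof. by rewrite {1}(counit_op v) op_P0 Q0 add0r addr0. Qed.

(** The eigenvalues are found one square root at a time: a^4 = 1 gives an
    eigenvalue +1 or -1 of a^2, then mu is a square root of it, and nu a square
    root of - mu^2, namely xi mu or - xi mu. *)
Lemma joint_eigenvector : exists mu nu u,
  [/\ u != 0, A u = u, mu ^+ 4 = 1, nu ^+ 2 = - mu ^+ 2 &
      al u = mu *: u /\ beta u = nu *: u].
Proof.
have [v0 nz_v0] := proj1 hVind.
have [u0 nz_u0 Au0] : exists2 u0, u0 != 0 & A u0 = u0.
  have [Av0|nz] := eqVneq (A v0) 0; last by exists (A v0); rewrite ?op_AA.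
  exists (C v0); last exact: op_AC.
  apply: contraNneq nz_v0 => Cv0.
  by rewrite [v0]split_AD Av0 add0r -op_BC Cv0 linear0.
have aaL : linear (fun v => al (al v)) by move=> r v w; rewrite !linearP.
have [|t [u1 [t2 nz_u1 au1 u1_def]]] := eigenvector_of_square aaL nz_u0 (s := 1).
  by rewrite act_a4 expr1n scale1r.
have Au1 : A u1 = u1 by case: u1_def => ->; rewrite ?linearD ?linearZ /= ?al_A Au0.
have [s s2] : exists s, s ^+ 2 = t.
  move/eqP: t2; rewrite eqf_sqr => /orP[] /eqP ->; first by exists 1; rewrite expr1n.
  by exists xi; rewrite expr2 xi2.
have aL : linear al := yd_act_linearr (ydP V) a.
have [|mu [u2 [mu2 nz_u2 au2 u2_def]]] := eigenvector_of_square aL nz_u1 (s := s).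
  by rewrite au1 s2.
have Au2 : A u2 = u2 by case: u2_def => ->; rewrite ?linearD ?linearZ /= ?al_A Au1.
have [|nu [u [nu2 nz_u bu u_def]]] := eigenvector_of_square beta_lin nz_u2 (s := xi * mu).
  rewrite -[LHS]opprK -al_sqr // au2 linearZ /= au2 scalerA -scaleNr.
  by rewrite exprMn [xi ^+ 2]expr2 xi2 mulN1r expr2.
exists mu, nu, u; split=> //.
- by case: u_def => ->; rewrite ?linearD ?linearZ /= ?A_beta Au2.
- by rewrite (exprM mu 2 2) mu2 s2 t2 expr1n.
- by rewrite nu2 exprMn [xi ^+ 2]expr2 xi2 mulN1r.
split=> //; case: u_def => -> //.
by rewrite linearD linearZ /= al_beta // au2 linearZ /= scalerDr !scalerA
  [mu * (_ * _)]mulrC.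
Qed.

(** Project a functional with value 1 at u onto the same eigenvalues, in the
    same order. *)
Lemma joint_eigenfunctional mu nu u : u != 0 -> A u = u -> mu ^+ 4 = 1 ->
  nu ^+ 2 = - mu ^+ 2 -> al u = mu *: u -> beta u = nu *: u ->
  exists f : V -> k^o, [/\ linear f, f u = 1, forall w, f (A w) = f w,
     forall w, f (al w) = mu * f w & forall w, f (beta w) = nu * f w].
Proof.
move=> nz_u Au mu4 nu2 au bu.
have mu_neq0 : mu != 0 by apply: contra_eq_neq mu4 => ->; rewrite expr0n eq_sym oner_eq0.
have nu_neq0 : nu != 0 by rewrite -sqrf_eq0 nu2 oppr_eq0 sqrf_eq0.
have aaL : linear (fun v => al (al v)) by move=> r v w; rewrite !linearP.
have aL : linear al := yd_act_linearr (ydP V) a.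
have bL := beta_lin.
have [f0 f0L f0u] := finite_dim_functional hVfin nz_u.
pose g0 w := f0 (A w).
have g0L : linear g0 by move=> r x y; rewrite /g0 linearP f0L.
pose g1 := halve (fun v => al (al v)) g0 (mu ^+ 2).
have g1L : linear g1 := halve_lin aaL (mu ^+ 2) g0L.
have g1A w : g1 (A w) = g1 w by rewrite /g1 /halve /g0 !al_A !op_AA.
have g1aa w : g1 (al (al w)) = mu ^+ 2 * g1 w.
  by apply: halve_eigen; rewrite act_a4 -exprM mu4 mul1r.
have g1u : g1 u = 1.
  rewrite /g1 (halve_id two_neq0 g0L) ?expf_neq0 //; first by rewrite /g0 Au.
  by rewrite au linearZ /= au scalerA expr2.
pose g2 := halve al g1 mu.
have g2L : linear g2 := halve_lin aL mu g1L.
have g2A w : g2 (A w) = g2 w by rewrite /g2 /halve -al_A !g1A.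
have g2a w : g2 (al w) = mu * g2 w by apply: halve_eigen.
have g2u : g2 u = 1 by rewrite /g2 (halve_id two_neq0 g1L mu_neq0 au).
exists (halve beta g2 nu); split.
- have h := halve_lin bL nu g2L. exact h.
- by rewrite (halve_id two_neq0 g2L nu_neq0 bu).
- by move=> w; rewrite /halve beta_A g2A.
- move=> w; rewrite /halve -beta_A al_A -al_beta ?op_AA // beta_A !g2a; ring.
move=> w; apply: halve_eigen; rewrite nu2 -(beta_A w).
have -> : beta (beta (A w)) = - al (al (A w)) by rewrite al_sqr ?op_AA ?opprK.
by rewrite (lin_opp g2L) !g2a g2A mulNr expr2 mulrA.
Qed.

(** The scalars by which p_op and q_op act on a joint eigenvector. *)
Definition p_eigen (mu nu : k) := 2%:R^-1 * (mu - xi * mu ^+ 3 - xi * nu + nu ^+ 3).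
Definition q_eigen (mu nu : k) := 2%:R^-1 * (xi * mu + mu ^+ 3 - nu - xi * nu ^+ 3).

(** The operators p_op and q_op are polynomials in a and beta, so f is also an
    eigenvector of their transposes.  Hence v |-> f(v) u + f(C v) B u commutes with
    the action and the coaction. *)
Lemma twodim_structure : exists mu nu u (f : V -> k^o),
  [/\ mu ^+ 4 = 1, nu ^+ 2 = - mu ^+ 2, linear f, A u = u & f u = 1] /\
  [/\ al u = mu *: u, al (B u) = nu *: B u,
      ch u = p_eigen mu nu *: B u, ch (B u) = q_eigen mu nu *: u &
      forall v, v = f v *: u + f (C v) *: B u].
Proof.
have [mu [nu [u [nz_u Au mu4 nu2 [au bu]]]]] := joint_eigenvector.
have [f [fL fu fA fa fb]] := joint_eigenfunctional nz_u Au mu4 nu2 au bu.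
have aBu : al (B u) = nu *: B u by rewrite al_B bu linearZ.
have aaau : al (al (al u)) = mu ^+ 3 *: u.
  by rewrite au !linearZ /= au !linearZ /= au !scalerA !exprS expr0 mulr1 mulrA.
have bbbu : beta (beta (beta u)) = nu ^+ 3 *: u.
  by rewrite bu !linearZ /= bu !linearZ /= bu !scalerA !exprS expr0 mulr1 mulrA.
have puE : p_op u = p_eigen mu nu *: u.
  apply: (scalerI two_neq0); rewrite p_op_double // aaau bbbu au bu !scalerA.
  rewrite -!scalerBl -scalerDl.
  by congr (_ *: _); rewrite /p_eigen; field.
have quE : q_op u = q_eigen mu nu *: u.
  apply: (scalerI two_neq0); rewrite q_op_double // aaau bbbu au bu !scalerA.
  rewrite -scalerDl -!scalerBl.
  by congr (_ *: _); rewrite /q_eigen; field.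
have cu : ch u = p_eigen mu nu *: B u by rewrite -[in LHS]Au ch_A puE linearZ.
have fp w : f (p_op w) = p_eigen mu nu * f w.
  apply: (mulfI two_neq0).
  have := congr1 f (p_op_double (op_AA w)).
  rewrite p_op_A (lin_scale fL) => E; apply: (etrans E).
  rewrite !(lin_add fL) !(lin_opp fL) !(lin_scale fL) !(fa, fb) fA.
  rewrite /p_eigen /GRing.scale /=.
  by field.
have fq w : f (q_op w) = q_eigen mu nu * f w.
  apply: (mulfI two_neq0).
  have := congr1 f (q_op_double (op_AA w)).
  rewrite q_op_A (lin_scale fL) => E; apply: (etrans E).
  rewrite !(lin_add fL) !(lin_opp fL) !(lin_scale fL) !(fa, fb) fA.
  rewrite /q_eigen /GRing.scale /=.
  by field.
have fB w : f (B w) = 0 by rewrite -fA op_AB (lin0 fL).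
have fD w : f (D w) = 0 by rewrite -fA op_AD (lin0 fL).
exists mu, nu, u, f; split=> //; split=> //.
pose e v : V := (f v : k) *: u + (f (C v) : k) *: B u.
suff eE : forall v, e v = v by move=> v; rewrite -[LHS]eE.
have opu i : op i u = (i == o1)%:R *: u + (i == o2)%:R *: B u.
  rewrite -[in LHS]Au; case: i => [[|[|[|[|[|[|[|[|i]]]]]]]]] //= lti; op_calc => //.
have opBu i : op i (B u) = (i == o3)%:R *: u + (i == o4)%:R *: B u.
  case: i => [[|[|[|[|[|[|[|[|i]]]]]]]]] //= lti; op_calc => //.
have eu : e u = u by rewrite /e fu scale1r -[in C u]Au op_CA (lin0 fL) scale0r addr0.
have eBu : e (B u) = B u by rewrite /e fB op_CB Au fu scale1r scale0r add0r.
have eL : linear e.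
  move=> r x y; rewrite /e linearP /= !fL !scalerDl -!scalerA scalerDr -!addrA.
  by congr (_ + _); rewrite addrCA.
apply: (idempotent_endomorphism hVind eL).
- by move=> v; rewrite {2}/e (lin_add eL) !(lin_scale eL) eu eBu.
- move=> v; rewrite {2}/e linearD !linearZ /= au aBu /e fa.
  have -> : C (al v) = beta (C v).
    by rewrite {1}[v]split_AD !linearD /= -al_A op_CA add0r -op_BC.
  by rewrite fb !scalerA [mu * _]mulrC [nu * _]mulrC.
- move=> v; rewrite {2}/e linearD !linearZ /= cu -/(q_op u) quE /e.
  have -> : f (ch v) = q_eigen mu nu * f (C v).
    by rewrite -fA A_act_c -op_BC -/(q_op _) fq.
  have -> : f (C (ch v)) = p_eigen mu nu * f v.
    rewrite {1}[v]split_AD !linearD /= -/(p_op v) -op_BC -/(q_op _) -A_q_op op_CA addr0.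
    exact: fp.
  by rewrite !scalerA [f v * _]mulrC [f (C v) * _]mulrC addrC.
- move=> i v; rewrite {2}/e linearD !linearZ /= opu opBu /e.
  by elim/ord8_ind: i; op_calc;
    rewrite ?op_X0 ?op_Y0 ?op_P0 ?Q0 ?fD ?fB ?fA ?(lin0 fL);
    rewrite ?(scaler0, scale0r, scale1r, addr0, add0r).
by exists u; rewrite eu.
Qed.

(** * The two-dimensional objects *)

Section TwoDim.

Variables (mu nu : k) (u : V) (f : V -> k^o).
Hypotheses (mu4 : mu ^+ 4 = 1) (nu2 : nu ^+ 2 = - mu ^+ 2) (fL : linear f).
Hypotheses (Au : A u = u) (fu : f u = 1) (au : al u = mu *: u)
  (aBu : al (B u) = nu *: B u).
Variables (p q : k) (cu : ch u = p *: B u) (cBu : ch (B u) = q *: u).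
Hypothesis Vu : forall v, v = f v *: u + f (C v) *: B u.

Let CBu : C (B u) = u. Proof. by rewrite -[RHS]Au; op_calc. Qed.
Let Cu : C u = 0. Proof. by rewrite -Au; op_calc. Qed.
Let Bu_neq0 : B u != 0.
Proof.
apply/eqP=> Bu0; have := CBu; rewrite Bu0 linear0 => u0.
by have := fu; rewrite -u0 (lin0 fL) => /esym/eqP; rewrite oner_eq0.
Qed.
Let fBu : f (B u) = 0.
Proof.
have := Vu (B u); rewrite CBu fu scale1r => /eqP.
rewrite -subr_eq0 opprD addrCA subrr addr0.
rewrite oppr_eq0 scaler_eq0 => /orP[/eqP//|/eqP u0].
by move: fu; rewrite u0 (lin0 fL) => /esym/eqP; rewrite oner_eq0.
Qed.

Lemma op_basis i v :
  op i v = f v *: ((i == o1)%:R *: u + (i == o2)%:R *: B u) +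
           f (C v) *: ((i == o3)%:R *: u + (i == o4)%:R *: B u).
Proof.
rewrite {1}[v]Vu linearD !linearZ /= -[in op i u]Au; congr (_ *: _ + _ *: _).
  by elim/ord8_ind: i; op_calc; rewrite ?Au.
by elim/ord8_ind: i; op_calc; rewrite ?Au.
Qed.

(** The scalar f (C v) is abstracted as t so that the formula, which itself
    contains an operator applied to v, can be used as a rewriting rule. *)
Lemma op_basis_gen v : exists2 t : k, t = f (C v) & forall i, op i v =
  f v *: ((i == o1)%:R *: u + (i == o2)%:R *: B u) +
  t *: ((i == o3)%:R *: u + (i == o4)%:R *: B u).
Proof. by exists (f (C v)) => // i; apply: op_basis. Qed.

Lemma act_basis h v : act yV h v = f v *: act yV h u + f (C v) *: act yV h (B u).
Proof. by rewrite {1}[v]Vu linearD !linearZ. Qed.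

(** If u is not in S, the coefficients f(v) u and f(C v) u of an element v of S
    can only be in S when they vanish. *)
Lemma twodim_simple : yd_simple V.
Proof.
split; first by case: hVind.
move=> S subS; have [[S0 Slin] _ _] := subS.
have SZ r w : w \in S -> r *: w \in S by move=> Sw; rewrite -[_ *: _]addr0 Slin.
have [Su|nSu] := boolP (u \in S); [right|left].
  move=> v; rewrite (Vu v) Slin // SZ //; exact: op_sub.
move=> v Sv; rewrite (Vu v).
have notS r : r *: u \in S -> r = 0.
  move=> Sru; have [//|nz_r] := eqVneq r 0; case/negP: nSu.
  by rewrite -[u](scalerK nz_r) SZ.
have -> : f v = 0.
  apply: notS; have := @op_sub S o1 v subS Sv.
  by rewrite op_basis /= ?(scale1r, scale0r, scaler0, addr0, add0r).
have -> : f (C v) = 0; last by rewrite !scale0r addr0.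
have SCv : C v \in S := @op_sub S o3 v subS Sv.
rewrite op_basis /= ?(scale1r, scale0r, scaler0, addr0, add0r) in SCv.
exact: notS.
Qed.

Let du : act yV d u = mu ^+ 3 *: u.
Proof. by rewrite act_d au !linearZ /= au !linearZ /= au !scalerA !exprS expr0 mulr1 mulrA. Qed.
Let dBu : act yV d (B u) = nu ^+ 3 *: B u.
Proof. by rewrite act_d aBu !linearZ /= aBu !linearZ /= aBu !scalerA !exprS expr0 mulr1 mulrA. Qed.
Let bu : act yV b u = (p * nu ^+ 2) *: B u.
Proof. by rewrite act_b cu !linearZ /= aBu !linearZ /= aBu !scalerA; congr (_ *: _); ring. Qed.
Let bBu : act yV b (B u) = (q * mu ^+ 2) *: u.
Proof. by rewrite act_b cBu !linearZ /= au !linearZ /= au !scalerA; congr (_ *: _); ring. Qed.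

(** When q = 0, c kills B u and the braiding multiplies B u (x) B u by the
    eigenvalue of d on B u, which is the inverse of nu. *)
Lemma nu_neq1 : q = 0 -> nu != 1.
Proof.
move=> q0; apply/eqP => nu1.
apply: (vector_criterion hR hchar hVfin hRfin Bu_neq0).
rewrite (@braiding_sum _ _ _ _ (ydP V) [:: (c, u); (d, B u)]); last first.
  by rewrite !big_cons big_nil coact_opE Au /=; op_calc.
rewrite !big_cons big_nil /= cBu dBu q0 nu1 expr1n scale0r scale1r.
by rewrite (lin0 (pure_linl _)) add0r addr0.
Qed.

(** When p = 0, b kills u and the braiding multiplies u (x) u by mu. *)
Lemma mu_neq1 : p = 0 -> mu != 1.
Proof.
move=> p0; apply/eqP => mu1.
have nz_u : u != 0 by apply: contraNneq Bu_neq0 => ->; rewrite linear0.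
apply: (vector_criterion hR hchar hVfin hRfin nz_u).
rewrite (@braiding_sum _ _ _ _ (ydP V) [:: (a, u); (b, B u)]); last first.
  by rewrite !big_cons big_nil -[in coact _ _]Au coact_opE Au /=; op_calc.
rewrite !big_cons big_nil /= au bu p0 mu1 mul0r scale0r scale1r.
by rewrite (lin0 (pure_linl _)) !addr0.
Qed.

(** When q = 0, u spans the quotient of V by B u, which is a braided quotient
    with braiding the scalar mu. *)
Lemma mu_neq1_dual : q = 0 -> mu != 1.
Proof.
move=> q0; apply/eqP => mu1.
apply: (functional_criterion_op fL (v := u)); first by rewrite fu oner_neq0.
move=> x w; have [t tE opx] := op_basis_gen x.
rewrite sum8 !opx /= ?(scale1r, scale0r, scaler0, addr0, add0r).
rewrite !(lin_scale fL) fu fBu (lin0 fL) /tnth /= (act_basis a) (act_basis c) au cu cBu aBu.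
rewrite !(lin_add fL) !(lin_scale fL) fu fBu q0 mu1 /GRing.scale /=.
by ring.
Qed.

(** When p = 0, B u spans the quotient of V by u, which is a braided quotient
    with braiding the inverse of nu. *)
Lemma nu_neq1_dual : p = 0 -> nu != 1.
Proof.
move=> p0; apply/eqP => nu1.
pose g v : k^o := f (C v).
have gL : linear g by move=> r x y; rewrite /g linearP fL.
have gu : g u = 0 by rewrite /g Cu (lin0 fL).
have gBu : g (B u) = 1 by rewrite /g CBu.
apply: (functional_criterion_op gL (v := B u)); first by rewrite gBu oner_neq0.
move=> x w; have [t tE opx] := op_basis_gen x.
rewrite sum8 !opx /= ?(scale1r, scale0r, scaler0, addr0, add0r).
rewrite !(lin_scale gL) gu gBu (lin0 gL) /tnth /= (act_basis b) (act_basis d) bu bBu du dBu.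
rewrite !(lin_add gL) !(lin_scale gL) gu gBu p0 nu1 /g -tE /GRing.scale /=.
by ring.
Qed.

Section Iso.
Variables (Ma Mb Mc Md : 'M[k]_2) (cf : 'cV[k]_2 -> K ⊗ 'cV[k]_2) (x y : 'cV[k]_2).
(** A linear map between two-dimensional spaces is a morphism once it is
    compatible with the generators on the basis u, B u. *)
Lemma twodim_iso :
  bijective (fun v => (f v : k) *: x + (f (C v) : k) *: y) ->
  Ma *m x = mu *: x -> Ma *m y = nu *: y ->
  Mb *m x = (p * nu ^+ 2) *: y -> Mb *m y = (q * mu ^+ 2) *: x ->
  Mc *m x = p *: y -> Mc *m y = q *: x ->
  Md *m x = mu ^+ 3 *: x -> Md *m y = nu ^+ 3 *: y ->
  (forall s t : k, cf (s *: x + t *: y) =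
    s *: (a ⊠ x + b ⊠ y) + t *: (c ⊠ x + d ⊠ y)) ->
  yd_iso V (YDData (Kact a b c d Ma Mb Mc Md) cf).
Proof.
set g := fun v => _ => gB ax ay bx by' cx cy dx dy cfE.
have gL : linear g.
  move=> r v w; rewrite /g linearP /= !fL !scalerDl -!scalerA scalerDr -!addrA.
  by congr (_ + _); rewrite addrCA.
have gu : g u = x by rewrite /g fu Cu (lin0 fL) scale1r scale0r addr0.
have gBu : g (B u) = y by rewrite /g fBu CBu fu scale1r scale0r add0r.
have g_act h M : M *m x = g (act yV h u) -> M *m y = g (act yV h (B u)) ->
    forall v, g (act yV h v) = M *m g v.
  move=> Mx My v; rewrite act_basis (lin_add gL) !(lin_scale gL) -Mx -My /g.
  by rewrite mulmxDr -!scalemxAr.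
apply: (yd_iso_Kact gL gB).
- by apply: g_act; rewrite ?au ?aBu (lin_scale gL) ?gu ?gBu.
- by apply: g_act; rewrite ?bu ?bBu (lin_scale gL) ?gu ?gBu.
- by apply: g_act; rewrite ?cu ?cBu (lin_scale gL) ?gu ?gBu.
- by apply: g_act; rewrite ?du ?dBu (lin_scale gL) ?gu ?gBu.
move=> v; have [t tE opv] := op_basis_gen v.
rewrite [in LHS]/g -tE cfE sum8 !opv /= ?(scale1r, scale0r, scaler0, addr0, add0r).
rewrite !(lin_scale gL) gu gBu (lin0 gL) !(lin0 (pure_linr _)) !addr0 add0r.
by rewrite !(lin_scale (pure_linr _)) /tnth /= !scalerDr !addrA.
Qed.
End Iso.

Let mu_neq0 : mu != 0.
Proof. by apply: contra_eq_neq mu4 => ->; rewrite expr0n eq_sym oner_eq0. Qed.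
Let nu4 : nu ^+ 4 = 1.
Proof. by rewrite (exprM nu 2 2) nu2 sqrrN -exprM mu4. Qed.
Let nu_neq0 : nu != 0.
Proof. by apply: contra_eq_neq nu4 => ->; rewrite expr0n eq_sym oner_eq0. Qed.

Let invX3 (t : k) : t ^+ 4 = 1 -> t^-1 = t ^+ 3.
Proof.
move=> t4; have nz_t : t != 0.
  by apply: contra_eq_neq t4 => ->; rewrite expr0n eq_sym oner_eq0.
by apply: (mulfI nz_t); rewrite divff // -exprS t4.
Qed.

Let diag_e1 (s t : k) : (s *: delta_mx 0 0 + t *: delta_mx 1 1) *m e1 k = s *: e1 k.
Proof.
by rewrite /e1 mulmxDl -!scalemxAl !mul_delta_mx_cond /= mulr1n mulr0n scaler0 addr0.
Qed.
Let diag_e2 (s t : k) : (s *: delta_mx 0 0 + t *: delta_mx 1 1) *m e2 k = t *: e2 k.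
Proof.
by rewrite /e2 mulmxDl -!scalemxAl !mul_delta_mx_cond /= mulr1n mulr0n scaler0 add0r.
Qed.
Let nil_e1 : (delta_mx 0 1 : 'M[k]_2) *m e1 k = 0.
Proof. by rewrite /e1 mul_delta_mx_cond. Qed.
Let nil_e2 : (delta_mx 0 1 : 'M[k]_2) *m e2 k = e1 k.
Proof. by rewrite /e2 mul_delta_mx_cond. Qed.

Let coord_e12 (s t : k) :
  ((s *: e1 k + t *: e2 k) 0 0 = s) * ((s *: e1 k + t *: e2 k) 1 0 = t).
Proof. by split; rewrite !mxE /= !mulr1 !mulr0 ?addr0 ?add0r. Qed.
Let eta_e12 (z : 'cV[k]_2) : z = z 0 0 *: e1 k + z 1 0 *: e2 k.
Proof.
apply/colP => i; rewrite !mxE; case: i => [[|[|i]]] //= lti;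
  rewrite ?mulr1 ?mulr0 ?addr0 ?add0r;
  by congr (z _ _); apply: val_inj.
Qed.

Let f_comb s t : f (s *: u + t *: B u) = s.
Proof. by rewrite (lin_add fL) !(lin_scale fL) fu fBu /GRing.scale /= mulr1 mulr0 addr0. Qed.
Let fC_comb s t : f (C (s *: u + t *: B u)) = t.
Proof.
by rewrite linearD !linearZ /= Cu CBu scaler0 add0r (lin_scale fL) fu /GRing.scale /= mulr1.
Qed.

(** Send u to e_2 and c u = p B u to e_1.  The scalar p' by which B u is sent to
    p' e_1 is the inverse of p since nu^4 = 1 and xi^2 = -1; it is the
    coefficient of b (x) e_1 in the coaction of e_2. *)
Lemma twodim1_iso i : nu = xi ^+ i -> nu = xi * mu -> p = nu ^+ 3 - xi * nu -> q = 0 ->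
  yd_iso V (twodim1 xi a b c d i).
Proof.
move=> nu_i nu_mu p_nu q0.
have mu_nu : mu = - xi * nu by rewrite nu_mu mulrA mulNr xi2 opprK mul1r.
pose p' := 2%:R^-1 * (nu + xi * nu ^+ 3).
have p'p : p' * p = 1.
  rewrite p_nu /p'.
  have -> : 2%:R^-1 * (nu + xi * nu ^+ 3) * (nu ^+ 3 - xi * nu) =
     2%:R^-1 * (nu ^+ 4 * (1 - xi * xi) + xi * nu ^+ 2 * (nu ^+ 4 - 1)) by ring.
  by rewrite nu4 subrr mulr0 addr0 mul1r xi2 opprK mulVf.
rewrite /twodim1 /twodim_act -nu_i.
apply: (twodim_iso (x := e2 k) (y := p' *: e1 k)).
- exists (fun z : 'cV[k]_2 => z 1 0 *: u + (z 0 0 * p) *: B u) => [v|z].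
    have -> : (f v : k) *: e2 k + (f (C v) : k) *: (p' *: e1 k) =
        (f (C v) * p') *: e1 k + (f v : k) *: e2 k by rewrite addrC scalerA.
    by rewrite !coord_e12 -mulrA p'p mulr1 -Vu.
  by rewrite f_comb fC_comb scalerA -mulrA [p * _]mulrC p'p mulr1 addrC -eta_e12.
- by rewrite diag_e2 mu_nu.
- by rewrite -scalemxAr diag_e1 !scalerA mulrC.
- by rewrite -scalemxAl nil_e2 scalerA mulrC mulrA p'p mul1r.
- by rewrite -!scalemxAr -!scalemxAl nil_e1 q0 !mul0r !scaler0 scale0r.
- by rewrite nil_e2 scalerA mulrC p'p scale1r.
- by rewrite -scalemxAr nil_e1 q0 scaler0 scale0r.
- rewrite diag_e2 mu_nu (invX3 nu4); congr (_ *: _).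
  have -> : (- xi * nu) ^+ 3 = - (xi * xi) * xi * nu ^+ 3 by ring.
  by rewrite xi2 opprK mul1r.
- by rewrite -scalemxAr diag_e1 (invX3 nu4) !scalerA mulrC.
move=> s t; rewrite /twodim_coact1 scalerA [s *: _ + _]addrC !coord_e12 addrC.
rewrite !(lin_scale (pure_linr _)) !(lin_scale (pure_linl _)).
rewrite -p_nu -/p'; congr (_ + _).
rewrite !scalerDr !scalerA -mulrA p'p mulr1 addrC; congr (_ + _).
Qed.

(** Send u to e_1 and B u to q e_2, so that c e_2 = e_1. *)
Lemma twodim3_iso i : mu = xi ^+ i -> nu = - xi * mu -> q = mu ^+ 3 + xi * mu -> p = 0 ->
  yd_iso V (twodim3 xi a b c d i).
Proof.
move=> mu_i nu_mu q_mu p0.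
pose q' := 2%:R^-1 * (mu - xi * mu ^+ 3).
have q'q : q' * q = 1.
  rewrite q_mu /q'.
  have -> : 2%:R^-1 * (mu - xi * mu ^+ 3) * (mu ^+ 3 + xi * mu) =
     2%:R^-1 * (mu ^+ 4 * (1 - xi * xi) + xi * mu ^+ 2 * (1 - mu ^+ 4)) by ring.
  by rewrite mu4 subrr mulr0 addr0 mul1r xi2 opprK mulVf.
rewrite /twodim3 /twodim_act -mu_i.
apply: (twodim_iso (x := e1 k) (y := q *: e2 k)).
- exists (fun z : 'cV[k]_2 => z 0 0 *: u + (z 1 0 * q') *: B u) => [v|z].
    by rewrite [_ *: (q *: _)]scalerA !coord_e12 -mulrA [q * _]mulrC q'q mulr1 -Vu.
  by rewrite f_comb fC_comb scalerA -mulrA q'q mulr1 -eta_e12.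
- by rewrite diag_e1.
- by rewrite -scalemxAr diag_e2 nu_mu !scalerA mulrC.
- by rewrite -scalemxAl nil_e1 p0 mul0r scale0r scaler0.
- by rewrite -!scalemxAr -!scalemxAl nil_e2 scalerA.
- by rewrite nil_e1 p0 scale0r.
- by rewrite -scalemxAr nil_e2.
- by rewrite diag_e1 (invX3 mu4).
- rewrite -scalemxAr diag_e2 nu_mu (invX3 mu4) !scalerA mulrC; congr (_ * _ *: _).
  have -> : (- xi * mu) ^+ 3 = - (xi * xi) * xi * mu ^+ 3 by ring.
  by rewrite xi2 opprK mul1r.
move=> s t; rewrite /twodim_coact3 scalerA !coord_e12.
rewrite !(lin_scale (pure_linr _)) !(lin_scale (pure_linl _)).
rewrite -q_mu -/q'; congr (_ + _).
by rewrite !scalerDr !scalerA -mulrA [q * _]mulrC q'q mulr1 addrC.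
Qed.

End TwoDim.

End YetterDrinfeldOverK.

(** * The classification *)

Theorem theorem1 (k : closedFieldType) (hchar : [pchar k] =i pred0)
    (xi : k) (hxi : 4.-primitive_root xi)
    (K : hopfAlg k) (a b c d : K) (hK : is_K xi a b c d)
    (V : ydMod K) (hVfin : finite_dim V) (hVind : yd_indecomposable V)
    (R : gradedBraidedHopf K) (hR : is_nichols V R) (hRfin : finite_dim R) :
  yd_simple V /\
  (yd_iso V (onedim xi a b c d 1) \/
   yd_iso V (onedim xi a b c d 3) \/
   yd_iso V (twodim1 xi a b c d 2) \/
   yd_iso V (twodim3 xi a b c d 2) \/
   yd_iso V (twodim1 xi a b c d 3) \/
   yd_iso V (twodim3 xi a b c d 3)).
Proof.
have xx := xi2 hxi.
have [[v0 Qv0]|Q0] := pselect (exists v0, op a b c d (V := V) o5 v0 != 0).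
  have [simV [iso1|iso3]] :=
    onedim_case hxi hK hchar hVfin hR hRfin hVind Qv0; split=> //.
    by left.
  by right; left.
have {}Q0 v : op a b c d o5 v = 0 :> V.
  by apply/eqP/negPn/negP => Qv; apply: Q0; exists v.
have [mu [nu [u [f [[mu4 nu2 fL Au fu] [au aBu cu cBu Vu]]]]]] :=
  twodim_structure hxi hK hchar hVfin hR hRfin hVind Q0.
have two_neq0 : (2%:R : k) != 0 := natr_neq0 hchar 1.
split; first exact: (twodim_simple hxi hK hVind Au Vu).
have mu_cases : [\/ mu = 1, mu = -1, mu = xi | mu = - xi].
  have : (mu ^+ 2) ^+ 2 == 1 by rewrite -exprM mu4.
  rewrite sqrf_eq1 => /orP[|].
    by rewrite sqrf_eq1 => /orP[] /eqP; [constructor 1|constructor 2].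
  by rewrite -xx -expr2 eqf_sqr => /orP[] /eqP; [constructor 3|constructor 4].
have : nu ^+ 2 == (xi * mu) ^+ 2 by rewrite exprMn [xi ^+ 2]expr2 xx mulN1r nu2.
rewrite eqf_sqr => /orP[] /eqP nuE.
  have pE : p_eigen xi mu nu = nu ^+ 3 - xi * nu.
    have -> : nu ^+ 3 - xi * nu = mu - xi * mu ^+ 3 by rewrite nuE; ring: xx.
    have -> : p_eigen xi mu nu = 2%:R^-1 * (2%:R * (mu - xi * mu ^+ 3)).
      by rewrite /p_eigen nuE; congr (_ * _); ring: xx.
    by rewrite mulrA mulVf ?mul1r.
  have qE : q_eigen xi mu nu = 0.
    by rewrite /q_eigen nuE; ring: xx.
  have nu_neq := nu_neq1 hxi hK hchar hVfin hR hRfin fL Au fu aBu cBu qE.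
  have mu_neq := mu_neq1_dual hxi hK hchar hR hRfin fL Au fu au aBu cu cBu Vu qE.
  have iso' i (nu_i : nu = xi ^+ i) : yd_iso V (twodim1 xi a b c d i).
    exact: (twodim1_iso hxi hK hchar mu4 nu2 fL Au fu au aBu cu cBu Vu nu_i nuE pE qE).
  case: mu_cases => muE.
  - by rewrite muE eqxx in mu_neq.
  - by do 4!right; left; apply: iso'; rewrite nuE muE; ring: xx.
  - by do 2!right; left; apply: iso'; rewrite nuE muE; ring: xx.
  by move: nu_neq; rewrite nuE muE mulrN xx opprK eqxx.
rewrite -mulNr in nuE.
have pE : p_eigen xi mu nu = 0.
  by rewrite /p_eigen nuE; ring: xx.
have qE : q_eigen xi mu nu = mu ^+ 3 + xi * mu.
  have -> : q_eigen xi mu nu = 2%:R^-1 * (2%:R * (mu ^+ 3 + xi * mu)).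
    by rewrite /q_eigen nuE; congr (_ * _); ring: xx.
  by rewrite mulrA mulVf ?mul1r.
have mu_neq := mu_neq1 hxi hK hchar hVfin hR hRfin fL Au fu au aBu cu pE.
have nu_neq := nu_neq1_dual hxi hK hchar hR hRfin fL Au fu au aBu cu cBu Vu pE.
have iso' i (mu_i : mu = xi ^+ i) : yd_iso V (twodim3 xi a b c d i).
  exact: (twodim3_iso hxi hK hchar mu4 fL Au fu au aBu cu cBu Vu mu_i nuE qE pE).
case: mu_cases => muE.
- by rewrite muE eqxx in mu_neq.
- by do 3!right; left; apply: iso'; rewrite muE; ring: xx.
- by move: nu_neq; rewrite nuE muE mulNr xx opprK eqxx.
by do 5!right; apply: iso'; rewrite muE; ring: xx.
Qed.
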